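(* Suppose $\mathfrak{pse}\leq\aleph_2$. Let $X$ be a compact Hausdorff weakly pseudoradial space. Then $X$ is pseudoradial if and only if there is no continuous surjection from $X$ onto $[0,1]^{\mathfrak{pse}}$.
   Context: Convergence: for an infinite cardinal $\kappa$ (which may be taken regular), a sequence $\{x_\alpha:\alpha<\kappa\}$ of points of a space $X$ converges to $x\in X$ if for every neighborhood $U$ of $x$, $|\{\alpha<\kappa : x_\alpha\notin U\}|<\kappa$. A subset $A\subseteq X$ is radially closed if there is no sequence $\{x_\alpha:\alpha<\kappa\}\subseteq A$ (for any $\kappa$) that converges to a point of $X\setminus A$. The radial closure $A^{(r)}$ of $A$ is the smallest radially closed subset of $X$ containing $A$. A space is pseudoradial if the radial closure of every subset is closed. A space is weakly pseudoradial if the radial closure of every countable subset is closed. The pseudoradial number is $\mathfrak{pse}=\min\{\kappa : 2^\kappa \text{ is not pseudoradial}\}$, where $2^\kappa=\{0,1\}^\kappa$ carries the product topology (of discrete two-point spaces) and $\kappa$ ranges over cardinals. $[0,1]^{\mathfrak{pse}}$ also has the product topology. *)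

(* Defs.v *)
From HB Require Import structures.
From mathcomp Require Import all_boot all_order all_algebra.
From mathcomp Require Import all_classical all_reals all_analysis.
Import numFieldNormedType.Exports.

Set Implicit Arguments.
Unset Strict Implicit.
Unset Printing Implicit Defensive.

Local Open Scope classical_set_scope.
Local Open Scope card_scope.

(* A cardinal is represented by any type of that cardinality; the order on
   cardinals is [#<=] between full sets. The alias fixes one universe for all of
   them. *)
Definition cardinal := Type.

Definition card_lt (T U : Type) (A : set T) (B : set U) : Prop :=
  A #<= B /\ ~ (B #<= A).

(* [K] has cardinality min {kappa : P kappa}, for [P] invariant under
   equipotence. *)
Definition least_card (P : cardinal -> Prop) (K : cardinal) : Prop :=
  P K /\ forall L : cardinal, P L -> [set: K] #<= [set: L].

Fixpoint is_aleph (n : nat) (K : cardinal) : Prop :=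
  if n is m.+1 then
    exists L : cardinal, is_aleph m L /\
      least_card (fun M : cardinal => card_lt [set: L] [set: M]) K
  else [set: K] #= [set: nat].

(* Convergence of a sequence indexed by a cardinal depends only on the number of
   exceptional indices, so the index type carries no well-order. *)
Definition kcvg (X : topologicalType) (K : cardinal) (u : K -> X) (x : X) : Prop :=
  forall U : set X, nbhs x U -> card_lt [set a | ~ U (u a)] [set: K].

Definition radially_closed (X : topologicalType) (A : set X) : Prop :=
  ~ exists (K : cardinal) (u : K -> X) (x : X),
      [/\ infinite_set [set: K], (forall a, A (u a)), kcvg u x & ~ A x].

Definition radial_closure (X : topologicalType) (A : set X) : set X :=
  smallest (@radially_closed X) A.

Definition pseudoradial (X : topologicalType) : Prop :=
  forall A : set X, closed (radial_closure A).

Definition weakly_pseudoradial (X : topologicalType) : Prop :=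
  forall A : set X, countable A -> closed (radial_closure A).

(* The type [bool] carries the discrete topology and [{ptws K -> _}] the product
   topology. *)
Definition is_pse (K : cardinal) : Prop :=
  least_card (fun L : cardinal => ~ pseudoradial {ptws L -> bool}) K.

(* A set coerces to the type of its elements, with the subspace topology. *)
Definition tychonoff_cube (R : realType) (K : cardinal) : topologicalType :=
  {ptws K -> (`[0%R, 1%R] : set R)}.

(* Main.v *)
Require Import Defs.
From HB Require Import structures.
From mathcomp Require Import all_boot all_order all_algebra.
From mathcomp Require Import all_classical all_reals all_analysis.
From mathcomp Require wochoice.
From mathcomp Require Import lra.
From Stdlib Require Inverse_Image List.
Import numFieldNormedType.Exports.

Local Open Scope classical_set_scope.
Local Open Scope card_scope.

Set Implicit Arguments.
Unset Strict Implicit.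
Unset Printing Implicit Defensive.

(** From left to right the statement is transport along closed maps. A Hausdorff
    image of a compact pseudoradial space is pseudoradial, and so is a closed
    subspace of the image; the corners of the cube [0,1]^pse form a closed copy
    of 2^pse, which is not pseudoradial ([pseudoradial_embedded]).

    The converse follows from a theorem that does not mention pse
    ([aleph2_cube_surjection]): let [A] be a radially closed subset of a compact
    Hausdorff space [X] that contains the closure of each of its countable
    subsets; if [A] is not closed, then [X] maps onto [0,1]^aleph2, hence onto
    every cube of at most that weight. Weak pseudoradiality gives the condition on
    countable subsets.

    Call a cardinal [J] an escape from [A] if there are [D] included in [A] and
    [J] continuous functions whose common zeros in the closure of [D] form a
    nonempty set [H] disjoint from [A]. A non-closed [A] has an escape; fix one
    of least cardinality ([minimal_escape]). Then the set [C j] of common zeros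
    of the functions before [j] meets [A], even inside a further zero set, the
    sets [C j] shrink to [H], and no countable subset of [J] is cofinal.

    On [H] one now runs the recursion of Shapirovskii's theorem on maps onto
    Tychonoff cubes. At stage [m] < aleph2 there are functions with indices
    below [m], and the finite conditions on their values that were kept so far
    all have a solution in [H]. If these conditions are dense at no point of [H]
    (each point has a neighbourhood that includes the solution set in [H] of no
    condition), then by compactness one function splits all conditions
    extending some condition [s0], and it is added ([splitting_function]). If
    this never fails, [s0] is the same at aleph2 stages ([pressing_down]), the
    functions of these stages are independent, and binary expansions turn them
    into a map onto the cube ([cube_surjection]).

    It cannot fail ([no_dense_point]). Suppose that the conditions are dense at
    [p] in [H]. A set of finite conditions always has a countable predense
    subset; so each neighbourhood [U] of [p] is governed by countably many
    conditions, although there may be aleph1 of them. For [j] in [J] and a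
    countable set [Q] of conditions, points of [A] chosen in [C j] according to
    the conditions in [Q] have a cluster point [q] in [A], because [Q] is
    countable, and [q] is close to every [U] governed by [Q]
    ([density_point]). Letting [Q] run through a chain of length omega1 gives
    points [q j w]. If [J] has cardinality aleph1, the diagonal of this matrix
    converges to [p]. Otherwise aleph1 is not an escape, hence every
    omega1-sequence in [A] clusters at a point of [A] ([not_escape_clusters]);
    cluster points of the rows form a sequence that converges to [p]. Both
    contradict that [A] is radially closed, since [p] is not in [A]. *)

(** * Cardinals and well-orders *)

Definition lept (T U : Type) : Prop := exists f : T -> U, injective f.

Lemma lept_trans (U T V : Type) : lept T U -> lept U V -> lept T V.
Proof. by move=> [f fI] [g gI]; exists (g \o f); apply: inj_comp. Qed.

Lemma lept_refl (T : Type) : lept T T.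
Proof. by exists id. Qed.

Lemma set_val_inj (T : Type) (A : set T) : injective (@set_val T A).
Proof. by move=> x y; apply: val_inj. Qed.

Lemma lept_set (T : Type) (A : set T) : lept A T.
Proof. by exists set_val; exact: set_val_inj. Qed.

Lemma lept_into (T U : Type) (A : set T) (f : U -> T) :
  injective f -> (forall u, A (f u)) -> lept U A.
Proof.
move=> fI fA; exists (fun u => SigSub (mem_set (fA u))).
by move=> x y /(congr1 val)/fI.
Qed.

Lemma card_le_lept (T U : Type) (A : set T) (B : set U) :
  A #<= B <-> lept A B.
Proof.
split=> [/card_leP/injfunPex[f _ fI]|[f fI]].
  by exists f; move=> x y; apply: fI; exact: mem_setT.
by apply/card_leP/injfunPex; exists f => // x y _ _; exact: fI.
Qed.

Lemma card_leTP (T U : Type) : [set: T] #<= [set: U] <-> lept T U.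
Proof.
rewrite card_le_lept; split=> [h|h].
  apply: lept_trans (lept_set _); apply: lept_trans h.
  by exists (fun x => SigSub (mem_setT x)); move=> x y /(congr1 val).
apply: (lept_trans (lept_set _)); apply: (lept_trans h).
by exists (fun x => SigSub (mem_setT x)); move=> x y /(congr1 val).
Qed.

Lemma countable_lept (T : Type) (A : set T) : countable A <-> lept A nat.
Proof.
rewrite /countable card_le_lept; split=> h.
  exact: lept_trans h (lept_set _).
by apply: (lept_trans h); exists (fun x => SigSub (mem_setT x)); move=> x y /(congr1 val).
Qed.

Lemma countableT_lept (T : Type) : countable [set: T] <-> lept T nat.
Proof. exact: card_leTP. Qed.

Lemma lept_subset (T : Type) (A B : set T) : A `<=` B -> lept A B.
Proof. by move=> /subset_card_le/card_le_lept. Qed.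

(** The Prop-valued strict form of a well-order, on a type without any structure. *)
Record wellorder (T : Type) (lt : T -> T -> Prop) : Prop := Wellorder {
  wo_wf : well_founded lt;
  wo_trans : forall x y z, lt x y -> lt y z -> lt x z;
  wo_tri : forall x y, [\/ lt x y, x = y | lt y x] }.

Lemma wo_irr (T : Type) (lt : T -> T -> Prop) : wellorder lt ->
  forall x, ~ lt x x.
Proof. by move=> w; apply: (well_founded_ind (wo_wf w)) => x IH h; exact: (IH x). Qed.

Lemma wo_nlt (T : Type) (lt : T -> T -> Prop) : wellorder lt ->
  forall x y, ~ lt x y -> x = y \/ lt y x.
Proof. by move=> w x y; case: (wo_tri w x y) => //; [left|right]. Qed.

Lemma wo_min (T : Type) (lt : T -> T -> Prop) (P : T -> Prop) : wellorder lt ->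
  (exists x, P x) -> exists2 x, P x & forall y, lt y x -> ~ P y.
Proof.
move=> w [x]; elim/(well_founded_ind (wo_wf w)): x => x IH Px.
have [[y [yx Py]]|h] := pselect (exists y, lt y x /\ P y); first exact: IH Py.
by exists x => // y yx Py; apply: h; exists y.
Qed.

Lemma wellorder_exists (T : Type) : exists lt : T -> T -> Prop, wellorder lt.
Proof.
have [R Rwo] := wochoice.well_ordering_principle {classic T}.
have Rch : {in predT &, total R} by apply: wochoice.wo_chainW => A _; exact: Rwo.
have Ranti : {in predT &, antisymmetric R}.
  by apply: wochoice.wo_chain_antisymmetric => A _; exact: Rwo.
have min (P : T -> Prop) : (exists x, P x) ->
    exists2 x, P x & forall y, P y -> R x y.
  move=> [x Px]; have [|z [[zP zmin] _]] := Rwo [pred x | `[<P x>]].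
    by exists x; apply/asboolP.
  exists z; first exact/asboolP.
  by move=> y Py; apply: zmin; apply/asboolP.
have wf (P : T -> Prop) : (exists x, P x) ->
    exists2 x, P x & forall y, R y x /\ y <> x -> ~ P y.
  move=> /min[x Px xmin]; exists x => // y [Ryx yx] Py; apply: yx.
  by apply: (Ranti y x) => //; rewrite Ryx xmin.
exists (fun x y => R x y /\ x <> y); split.
- move=> x; apply: contrapT => nx.
  have [|y ny ymin] := wf (fun x => ~ Acc (fun x y => R x y /\ x <> y) x).
    by exists x.
  by apply: ny; split=> z /ymin/contrapT.
- move=> x y z [Rxy xy] [Ryz yz].
  have [|t [->|[->|->]] tmin] := min (fun t => t = x \/ (t = y \/ t = z)).
  + by exists x; left.
  + split; first by apply: tmin; right; right.
    by move=> xz; apply: xy; apply: (Ranti x y) => //; rewrite Rxy xz.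
  + case: xy; apply: (Ranti x y) => //; rewrite Rxy tmin //; by left.
  + case: yz; apply: (Ranti y z) => //; rewrite Ryz tmin //; by right; left.
- move=> x y; have [->|xy] := pselect (x = y); first exact: Or32.
  have /orP[h|h] := Rch x y isT isT; first exact: Or31.
  by apply: Or33; split=> // /esym.
Qed.

(** Transfinite recursion in which the value at [w] is only required to be
    related to the earlier values by [Q]. The relation receives the whole
    function [d], and extensionality says that it looks at earlier values only. *)
Lemma wf_choice (W V : Type) (lt : W -> W -> Prop)
    (Q : W -> (W -> V) -> V -> Prop) :
  well_founded lt ->
  (forall w d d' v, (forall w', lt w' w -> d w' = d' w') -> Q w d v -> Q w d' v) ->
  (forall w d, (forall w', lt w' w -> Q w' d (d w')) -> exists v, Q w d v) ->
  (W -> V) -> exists d, forall w, Q w d (d w).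
Proof.
move=> wf Qext Qex d0.
pose ext w (r : forall w', lt w' w -> V) w' :=
  if pselect (lt w' w) is left h then r w' h else d0 w'.
pose F w r : V :=
  if pselect (exists v, Q w (@ext w r) v) is left h then projT1 (cid h) else d0 w.
pose d := Fix wf (fun=> V) F.
have dE w : d w = F w (fun w' _ => d w').
  rewrite /d Fix_eq // => x f g fg; congr F; apply: functional_extensionality_dep.
  by move=> y; apply: functional_extensionality_dep => h; exact: fg.
exists d; apply: (well_founded_ind wf) => w IH.
have ext_d w' : lt w' w -> ext w (fun w' _ => d w') w' = d w'.
  by rewrite /ext; case: pselect.
rewrite dE /F; case: pselect => [h|[]].
  by case: (cid h) => v /=; apply: Qext.
have [v Qv] := Qex w d IH; exists v; apply: Qext Qv => w' /ext_d.
by [].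
Qed.

(** The values of an injection can be chosen one after the other: at [w] the
    earlier values cannot exhaust [U]. *)
Lemma lept_of_small_segments (W U : Type) (lt : W -> W -> Prop) :
  wellorder lt -> (forall w, ~ lept U [set w' | lt w' w]) -> lept W U.
Proof.
move=> wo small.
have inhU (w : W) : inhabited U.
  apply: contrapT => nU; apply: (small w).
  by exists (fun u => match nU (inhabits u) with end); move=> u; case: nU.
have [h hP] : exists h : W -> U, forall w w', lt w' w -> h w' <> h w.
  have [f0] : inhabited (W -> U).
    have inhU' (w : W) : exists _ : U, True by have [u] := inhU w; exists u.
    exact: inhabits (fun w => projT1 (cid (inhU' w))).
  apply: (wf_choice (Q := fun w h v => forall w', lt w' w -> h w' <> v)) f0.
  - exact: wo_wf wo.
  - by move=> w d d' v dd' h w' ww'; rewrite -dd' //; exact: h.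
  - move=> w d _; apply: contrapT => nov; apply: (small w).
    have /choice[g gP] (u : U) : exists w', lt w' w /\ d w' = u.
      apply: contrapT => nw; apply: nov; exists u => w' ww' dw'.
      by apply: nw; exists w'.
    apply: (lept_into (f := g)) => [u u' gg|u]; last by case: (gP u).
    by rewrite -(proj2 (gP u)) -(proj2 (gP u')) gg.
exists h => x y hxy; have [xy|//|yx] := wo_tri wo x y.
  by have := hP _ _ xy.
by have := hP _ _ yx; rewrite hxy.
Qed.

Lemma lept_total (T U : Type) : lept T U \/ lept U T.
Proof.
have [lt wo] := wellorder_exists T.
have [[w [f fI]]|h] := pselect (exists w, lept U [set w' | lt w' w]).
  by right; apply: lept_trans (lept_set [set w' | lt w' w]); exists f.
by left; apply: (lept_of_small_segments wo) => w Uw; apply: h; exists w.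
Qed.

Lemma wo_pullback (W T : Type) (lt : T -> T -> Prop) (f : W -> T) :
  injective f -> wellorder lt -> wellorder (fun x y => lt (f x) (f y)).
Proof.
move=> fI wo; split.
- apply: (Inverse_Image.wf_inverse_image _ _ lt f); exact: wo_wf wo.
- by move=> x y z; apply: wo_trans wo _ _ _.
- move=> x y; have [xy|xy|xy] := wo_tri wo (f x) (f y); first exact: Or31.
  + by apply: Or32; exact: fI.
  + exact: Or33.
Qed.

(** If [K] embeds into a proper segment of a well-order, pull the order back
    along an embedding into the least such segment. *)
Lemma initial_wellorder (K : Type) : exists lt : K -> K -> Prop,
  wellorder lt /\ forall w, ~ lept K [set w' | lt w' w].
Proof.
have [lt wo] := wellorder_exists K.
have [h|h] := pselect (exists w, lept K [set w' | lt w' w]); last first.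
  by exists lt; split=> // w Kw; apply: h; exists w.
have [w [g gI] wmin] := wo_min wo h.
have gI' : injective (fun x => val (g x)) by move=> x y /val_inj/gI.
exists (fun x y => lt (val (g x)) (val (g y))); split; first exact: wo_pullback gI' wo.
move=> x Kx; apply: (wmin (val (g x)) (set_valP (g x))).
apply: (lept_trans Kx).
apply: (lept_into (f := fun y => val (g (val y)))) => [y z /gI'/val_inj//|y].
exact: (set_valP y).
Qed.

Lemma lept_mul (T T' U U' : Type) : lept T T' -> lept U U' ->
  lept (T * U) (T' * U').
Proof.
move=> [f fI] [g gI]; exists (fun x => (f x.1, g x.2)).
by move=> [a b] [c d] /= [/fI-> /gI->].
Qed.

Lemma lept_nat2 : lept (nat * nat) nat.
Proof. by apply/countableT_lept; exact: countableP. Qed.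

(** The segments of the lexicographic order on [W * nat] are no larger than the
    product of a segment of [W] with [nat]. *)
Lemma lept_mul_nat (W U : Type) (lt : W -> W -> Prop) : wellorder lt ->
  (forall w, ~ lept U ([set w' | lt w' w \/ w' = w] * nat)) ->
  lept (W * nat) U.
Proof.
move=> wo small.
pose lex (x y : W * nat) := lt x.1 y.1 \/ x.1 = y.1 /\ (x.2 < y.2)%N.
have wolex : wellorder lex.
  split.
  - move=> [w n]; elim/(well_founded_ind (wo_wf wo)): w n => w IH n.
    elim/ltn_ind: n => n IHn; split=> -[w' n'] /= [/= ww'|/= [-> nn']].
      exact: IH.
    exact: IHn.
  - move=> [x1 x2] [y1 y2] [z1 z2]; rewrite /lex /=.
    move=> [xy|[-> xy]] [yz|[<- yz]].
    + by left; apply: wo_trans wo _ _ _ xy yz.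
    + by left.
    + by left.
    + by right; split=> //; exact: ltn_trans yz.
  - move=> [x1 x2] [y1 y2]; rewrite /lex /=.
    have [xy|<-|xy] := wo_tri wo x1 y1; [exact/Or31/or_introl| |exact/Or33/or_introl].
    case: (ltngtP x2 y2) => [xy|xy|->]; [exact/Or31/or_intror|exact/Or33/or_intror|].
    exact: Or32.
apply: (lept_of_small_segments wolex) => -[w n] Uw; apply: (small w).
apply: (lept_trans Uw).
have le (y : [set w' | lex w' (w, n)]) : [set w' | lt w' w \/ w' = w] (val y).1.
  by have [|[? _]] := set_valP y; [left|right].
exists (fun y => (SigSub (mem_set (le y)), (val y).2)).
by move=> y z [/= e1 e2]; apply: val_inj; exact: injective_projections.
Qed.

Lemma card_ltTP (T U : Type) :
  card_lt [set: T] [set: U] <-> lept T U /\ ~ lept U T.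
Proof. by rewrite /card_lt !card_leTP. Qed.

Lemma is_alephSP (n : nat) (K : cardinal) : is_aleph n.+1 K ->
  exists L : cardinal, [/\ is_aleph n L, ~ lept K L &
    forall M : cardinal, ~ lept M L -> lept K M].
Proof.
case=> L [nL [/card_ltTP[_ KL] Kmin]]; exists L; split=> // M ML.
apply/card_leTP/Kmin/card_ltTP; split=> //.
by case: (lept_total L M).
Qed.

Lemma least_segments (K L : cardinal) :
  (forall M : cardinal, ~ lept M L -> lept K M) ->
  exists lt : K -> K -> Prop,
    wellorder lt /\ forall w, lept [set w' | lt w' w] L.
Proof.
move=> Kmin; have [lt [wo init]] := initial_wellorder K.
exists lt; split=> // w; apply: contrapT => h.
exact: (init w (Kmin _ h)).
Qed.

Lemma is_aleph0P (K : cardinal) : is_aleph 0 K -> lept K nat /\ lept nat K.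
Proof. by move=> /card_eqPle[/card_leTP ? /card_leTP ?]. Qed.

Lemma is_aleph1P (L : cardinal) : is_aleph 1 L ->
  [/\ ~ lept L nat, forall M : cardinal, ~ lept M nat -> lept L M
    & exists lt : L -> L -> Prop,
        wellorder lt /\ forall w, lept [set w' | lt w' w] nat].
Proof.
move=> /is_alephSP[N [/is_aleph0P[Nn nN] LN Lmin]].
have Lmin' (M : cardinal) : ~ lept M nat -> lept L M.
  by move=> h; apply: Lmin => h'; apply: h; exact: lept_trans Nn.
split=> //; last exact: least_segments.
by move=> h; apply: LN; exact: lept_trans nN.
Qed.

Lemma lept_le_segment (T : Type) (lt : T -> T -> Prop) (w : T) :
  lept [set w' | lt w' w] nat -> lept [set w' | lt w' w \/ w' = w] nat.
Proof.
move=> /countable_lept cw; apply/countable_lept.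
rewrite (_ : [set _ | _] = [set w' | lt w' w] `|` [set w]) //.
by rewrite -bigcup2E; apply: bigcup_countable => // -[|[|n]] _ /=.
Qed.

(** The pair [(a, b)] is coded by its maximum [m] together with the ranks of
    [a] and [b] in a fixed enumeration of the countable segment of [m]. *)
Lemma lept_mul_self (L : Type) (lt : L -> L -> Prop) : wellorder lt ->
  (forall w, lept [set w' | lt w' w] nat) -> ~ lept L nat ->
  lept (L * nat) L /\ lept (L * L) L.
Proof.
move=> wo cseg Lunc.
have cle w : lept [set w' | lt w' w \/ w' = w] nat by exact: lept_le_segment.
have Ln : lept (L * nat) L.
  apply: (lept_mul_nat wo) => w Lw; apply: Lunc; apply: (lept_trans Lw).
  exact: lept_trans (lept_mul (cle w) (lept_refl nat)) lept_nat2.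
split=> //.
have /choice[e eI] (w : L) : exists e : L -> nat,
    {in [set w' | lt w' w \/ w' = w] &, injective e}.
  by have /countable_lept/countable_injP := cle w.
pose mx (x : L * L) := if pselect (lt x.1 x.2) is left _ then x.2 else x.1.
have mxP x : [set w' | lt w' (mx x) \/ w' = mx x] x.1 /\
             [set w' | lt w' (mx x) \/ w' = mx x] x.2.
  rewrite /mx /=; case: pselect => [h|/(wo_nlt wo)[->|h]] /=;
    by split; auto.
apply: lept_trans Ln; apply: (lept_trans (U := L * (nat * nat))); last first.
  exact: lept_mul (lept_refl _) lept_nat2.
exists (fun x => (mx x, (e (mx x) x.1, e (mx x) x.2))).
move=> x y [exy]; have [x1 x2] := mxP x; have [y1 y2] := mxP y; move: x1 x2.
rewrite exy => x1 x2 h1 h2.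
by apply: injective_projections; [apply: eI h1|apply: eI h2]; exact: mem_set.
Qed.

Lemma lept_bigcup (L I T : Type) (D : set I) (F : I -> set T) :
  lept (L * L) L -> lept D L -> (forall i, D i -> lept (F i) L) ->
  lept (\bigcup_(i in D) F i) L.
Proof.
move=> LL [d dI] FL; apply: lept_trans LL.
have [e eI] : exists e : forall i : D, F (val i) -> L, forall i, injective (e i).
  have H (i : D) : exists f : F (val i) -> L, injective f by exact: FL (set_valP i).
  exists (fun i => projT1 (cid (H i))) => i.
  exact: projT2 (cid (H i)).
have H (x : \bigcup_(i in D) F i) : exists i : D, F (val i) (val x).
  have [i Di Fi] := set_valP x; exists (SigSub (mem_set Di)) => //=.
pose i x := projT1 (cid (H x)).
have Fi x : F (val (i x)) (val x) := projT2 (cid (H x)).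
exists (fun x => (d (i x), e (i x) (SigSub (mem_set (Fi x))))).
move=> x y [/dI]; move: (Fi x) (Fi y); move: (i x) (i y) => ix iy hx hy exy.
by subst iy => /eI/(congr1 val)/= /val_inj.
Qed.

Lemma lept_seq (L T : Type) : lept nat L -> lept (L * L) L -> lept T L ->
  lept (seq T) L.
Proof.
move=> [g gI] LL [f fI]; have [c cI] := LL.
apply: (lept_trans (U := L * L)) LL.
pose code := foldr (fun t a => c (f t, a)) (g 0).
exists (fun s => (g (size s), code s)) => s t [/gI].
elim: s t => [|x s IH] [|y t] //= [st] /cI[/fI -> e].
by rewrite (IH t).
Qed.

(** * Compactness and zero sets *)

Local Open Scope ring_scope.
Import Order.TTheory GRing.Theory Num.Theory.

(** The form of compactness used throughout: lists of closed sets avoid any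
    choice structure on the index type. *)
Lemma compact_centered (X : topologicalType) (C : set (set X)) :
  compact [set: X] -> (forall F, C F -> closed F) ->
  (forall l : seq (set X), (forall F, List.In F l -> C F) ->
     exists x, forall F, List.In F l -> F x) ->
  exists x, forall F, C F -> F x.
Proof.
move=> cX Ccl Cfin.
pose Flt : set_system X := [set S | exists l : seq (set X),
  (forall F, List.In F l -> C F) /\
  (forall x, (forall F, List.In F l -> F x) -> S x)].
have FF : ProperFilter Flt.
  split; first by move=> [l [lC l0]]; have [x xl] := Cfin l lC; exact: l0 xl.
  split.
  - by exists [::]; split.
  - move=> P Q [l [lC lP]] [m [mC mQ]]; exists (l ++ m); split.
      by move=> F h; case: (List.in_app_or _ _ _ h) => [/lC|/mC].
    move=> x xlm; split; [apply: lP|apply: mQ] => F Fl; apply: xlm;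
      by apply: List.in_or_app; auto.
  - by move=> P Q PQ [l [lC lP]]; exists l; split=> // x /lP/PQ.
have [p [_ pcl]] := cX Flt FF filterT.
exists p => F CF; apply: (Ccl F CF) => V Vp; apply: pcl => //; exists [:: F]; split=> [G [<-//|[]]|x]; apply.
by left.
Qed.

Lemma compact_directed (X : topologicalType) (I : Type) (F : I -> set X) :
  compact [set: X] -> inhabited I -> (forall i, closed (F i)) ->
  (forall i, exists x, F i x) ->
  (forall i j, exists k, F k `<=` F i /\ F k `<=` F j) ->
  exists x, forall i, F i x.
Proof.
move=> cX [i0] Fcl Fne Fdir.
have [|l lF|x xF] := compact_centered (C := range F) cX; last 1 first.
- by exists x => i; apply: xF; exists i.
- by move=> _ [i _ <-].
have [i iF] : exists i, forall G, List.In G l -> F i `<=` G.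
  elim: l lF => [|G l IH] lF; first by exists i0.
  have [|i iF] := IH; first by move=> G' G'l; apply: lF; right.
  have [|j _ FjG] := lF G; first by left.
  have [k [ki kj]] := Fdir i j; exists k => G' [<-|/iF h].
    by rewrite -FjG.
  exact: subset_trans h.
by have [x xi] := Fne i; exists x => G /iF; apply.
Qed.

Section ZeroSets.
Context (R : realType) (X : topologicalType).

Lemma zero_closed (g : X -> R) : continuous g -> closed [set x | g x = 0].
Proof.
by move=> gc; apply: (@preimage_closed _ _ g [set 0]) => [x _|]; [exact: gc|exact: closed_eq].
Qed.

Lemma continuous_absD (g h : X -> R) : continuous g -> continuous h ->
  continuous (fun x => `|g x| + `|h x|).
Proof.
by move=> gc hc x; apply: cvgD; apply: cvg_norm; [exact: gc|exact: hc].
Qed.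

Lemma absD_eq0 (g h : X -> R) x : `|g x| + `|h x| = 0 <-> g x = 0 /\ h x = 0.
Proof.
split=> [/eqP|[-> ->]]; last by rewrite !normr0 addr0.
by rewrite paddr_eq0 // !normr_eq0 => /andP[/eqP ? /eqP].
Qed.

Lemma closed_zeros (J : Type) (D : set X) (f : J -> X -> R) (P : J -> Prop) :
  (forall j, continuous (f j)) ->
  closed [set x | closure D x /\ forall j, P j -> f j x = 0].
Proof.
move=> fc; rewrite (_ : mkset _ =
    closure D `&` \bigcap_(j in P) [set x | f j x = 0]) //.
apply: closedI; first exact: closed_closure.
by apply: closed_bigI => j _; exact: zero_closed.
Qed.

End ZeroSets.

(** * How many functions separate a set from a point of its closure *)

Section Escape.
Context (R : realType) (X : topologicalType) (A : set X).

Definition omega_closed := forall B, countable B -> B `<=` A -> closure B `<=` A.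

(** The closed set is presented as the closure of a subset of [A], so that [A]
    is dense in it. Letting [D] vary makes the least escape small enough: any
    sequence in [A] may be taken as a new [D]. *)
Definition escape (J : Type) := exists (D : set X) (f : J -> X -> R),
  [/\ D `<=` A, forall j, continuous (f j),
      exists x, closure D x /\ forall j, f j x = 0 &
      ~ exists a, [/\ A a, closure D a & forall j, f j a = 0]].

(** Superfluous indices receive the zero function. *)
Lemma escape_mono (J L : Type) : lept J L -> escape J -> escape L.
Proof.
move=> [g gI] [D [f [DA fc [x [Dx fx]] nA]]].
pose f' l : X -> R :=
  if pselect (exists j, g j = l) is left h then f (projT1 (cid h)) else fun=> 0.
have f'g j : f' (g j) = f j.
  by rewrite /f'; case: pselect => [h|[]]; [case: cid => k /= /gI->|exists j].
exists D, f'; split=> //.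
- move=> l; rewrite /f'; case: pselect => [h|_]; first exact: fc.
  by move=> y; exact: cvg_cst.
- by exists x; split=> // l; rewrite /f'; case: pselect.
- by move=> [a [Aa Da fa]]; apply: nA; exists a; split=> // j; rewrite -f'g.
Qed.

Context (cX : compact [set: X]).

(** Choose points of [D] at which the first [n] functions are smaller than
    1 / (n + 1). They cluster at a point of [A], where all functions vanish. *)
Lemma not_escape_nat : omega_closed -> ~ escape nat.
Proof.
move=> Aw [D [f [DA fc [x [Dx fx]] nA]]].
have cvx n : nbhs x [set y | forall i, (i <= n)%N -> `|f i y| < n.+1%:R^-1].
  suff H m : nbhs x [set y | forall i, (i < m)%N -> `|f i y| < n.+1%:R^-1].
    by apply: filterS (H n.+1) => y h i ilen; apply: h.
  elim: m => [|m IH]; first exact: filterE.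
  have : nbhs x [set y | `|f m y| < n.+1%:R^-1].
    have : f m y @[y --> x] --> (0 : R) by rewrite -(fx m); exact: fc.
    move=> /cvgrPdist_lt/(_ n.+1%:R^-1).
    rewrite invr_gt0 ltr0n => /(_ isT).
    by apply: filterS => y /=; rewrite sub0r normrN.
  apply: filterS2 IH => y h hm i; rewrite ltnS leq_eqVlt => /predU1P[->//|].
  exact: h.
have /choice[a aP] n : exists y, D y /\ forall i, (i <= n)%N -> `|f i y| < n.+1%:R^-1.
  by have [y [Dy yP]] := Dx _ (cvx n); exists y.
have [|||y yP] := compact_directed
  (F := fun n => closure [set a m | m in [set m | (n <= m)%N]]) cX (inhabits 0%N).
- by move=> n; exact: closed_closure.
- by move=> n; exists (a n); apply: subset_closure; exists n => /=.
- move=> i j; exists (maxn i j); split; apply: closure_subset;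
    by apply: image_subset => m /=; rewrite geq_max => /andP[].
apply: nA; exists y; split.
- apply: (Aw (range a)); first exact: (sub_countable (card_image_le _ _) (countableP _)).
    by move=> _ [n _ <-]; apply: DA; case: (aP n).
  apply: (closure_subset (A := [set a m | m in [set m | (0 <= m)%N]])) (yP 0%N).
  exact: image_subset.
- apply: closure_subset (yP 0%N) => _ [n _ <-].
  by case: (aP n).
- move=> j; apply/eqP; rewrite -normr_le0.
  have fy n : (j <= n)%N -> `|f j y| <= n.+1%:R^-1.
    move=> jn; have cl : closed [set z | `|f j z| <= n.+1%:R^-1].
      apply: (@preimage_closed _ _ (fun z => `|f j z|) [set r | r <= n.+1%:R^-1]).
        by move=> z _; apply: cvg_norm; exact: fc.
      exact: closed_le.
    apply: cl; apply: closure_subset (yP n) => _ [m /= nm <-].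
    have [_ /(_ j (leq_trans jn nm))/ltW/le_trans] := aP m; apply.
    by rewrite lef_pV2 ?posrE ?ltr0n // ler_nat ltnS.
  rewrite leNgt; apply/negP => f0.
  pose n := maxn j (Num.truncn `|f j y|^-1).
  have := fy n (leq_maxl _ _); rewrite leNgt => /negP; apply.
  rewrite -[ltRHS]invrK ltf_pV2 ?posrE ?invr_gt0 ?ltr0n //.
  apply: (lt_le_trans (Num.Theory.truncnS_gt _)); rewrite ler_nat ltnS; exact: leq_maxr.
Qed.

Lemma not_escape_countable (J : Type) : omega_closed -> lept J nat -> ~ escape J.
Proof. by move=> Aw Jn /(escape_mono Jn); exact: not_escape_nat. Qed.

(** Cut a well-ordered escape at the least segment that is an escape. Minimality
    also makes the order initial: no segment is as large as the whole. *)
Lemma minimal_escape (J0 : Type) : escape J0 ->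
  exists (J : Type) (lt : J -> J -> Prop), [/\ wellorder lt, escape J,
    forall (j : J) (L : Type), lept L [set i | lt i j] -> ~ escape L &
    forall j : J, ~ lept J [set i | lt i j]].
Proof.
have [lt wo] := wellorder_exists J0 => bJ.
have [h|h] := pselect (exists j, escape [set i | lt i j]); last first.
  have nb j (L : Type) : lept L [set i | lt i j] -> ~ escape L.
    by move=> Lj /(escape_mono Lj) b; apply: h; exists j.
  by exists J0, lt; split=> // j /nb.
have [j bj jmin] := wo_min wo h.
pose J : Type := [set i | lt i j].
have Jmin (k : J) (L : Type) : lept L [set i : J | lt (val i) (val k)] -> ~ escape L.
  move=> Lk bL; apply: (jmin (val k) (set_valP k)).
  apply: escape_mono bL; apply: (lept_trans Lk).
  apply: (lept_into (f := fun y => val (val y))).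
    by move=> y z /val_inj/val_inj.
  by move=> y; exact: (set_valP y).
exists J, (fun x y => lt (val x) (val y)); split.
- by apply: wo_pullback wo; exact: val_inj.
- exact: bj.
- exact: Jmin.
- by move=> k Jk; exact: (Jmin k J Jk bj).
Qed.

End Escape.

(** * A separating family of least cardinality *)

Section MinimalEscape.
Context (R : realType) (X : topologicalType) (A : set X).
Context (cX : compact [set: X]) (Aw : omega_closed A).
Context (J : Type) (lt : J -> J -> Prop) (wo : wellorder lt).
Context (Jmin : forall (j : J) (L : Type),
  lept L [set i | lt i j] -> ~ escape R A L).
Context (D : set X) (f : J -> X -> R) (DA : D `<=` A).
Context (fc : forall j, continuous (f j)).

Definition residue := [set x | closure D x /\ forall j, f j x = 0].
Definition approx (j : J) := [set x | closure D x /\ forall i, lt i j -> f i x = 0].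

Context (H0 : exists x, residue x) (HA : forall a, A a -> ~ residue a).

Lemma residue_closed : closed residue.
Proof.
rewrite (_ : residue = [set x | closure D x /\ forall j, True -> f j x = 0]).
  exact: closed_zeros.
by apply/seteqP; split=> x [Dx fx]; split=> // j *; exact: fx.
Qed.

Lemma approx_closed j : closed (approx j).
Proof. exact: closed_zeros. Qed.

Lemma residue_approx j : residue `<=` approx j.
Proof. by move=> x [Dx fx]; split. Qed.

Lemma approx_anti i j : i = j \/ lt i j -> approx j `<=` approx i.
Proof.
move=> [->//|ij] x [Dx fx]; split=> // k ki; apply: fx; exact: wo_trans wo _ _ _ ki ij.
Qed.

(** Fewer functions than [J] are not an escape, and one more function [h] can be
    absorbed into those before [j] without changing their number. *)
Lemma approx_meets (j : J) (h : X -> R) : continuous h ->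
  (exists x, approx j x /\ h x = 0) -> exists a, [/\ A a, approx j a & h a = 0].
Proof.
move=> hc [x [[Dx fx] hx]].
have [[i0 i0j]|nseg] := pselect (exists i, lt i j).
  have nb := Jmin (lept_refl [set i | lt i j]).
  apply: contrapT => nA; apply: nb.
  exists D, (fun i y => `|f (val i) y| + `|h y|); split=> //.
  - by move=> i; exact: continuous_absD.
  - by exists x; split=> // i; apply/absD_eq0; split=> //; apply: fx; exact: (set_valP i).
  - move=> [a [Aa Da fa]]; apply: nA; exists a; split=> //; first split=> //.
      move=> i ij; have := fa (SigSub (mem_set (ij : [set i | lt i j] i))).
      by move=> /absD_eq0[].
    have := fa (SigSub (mem_set (i0j : [set i | lt i j] i0))).
    by move=> /absD_eq0[].
have nb : ~ escape R A unit.
  by apply: (not_escape_countable cX Aw); exists (fun=> 0%N) => -[] [].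
apply: contrapT => nA; apply: nb; exists D, (fun _ => h); split=> //.
  by exists x.
move=> [a [Aa Da fa]]; apply: nA; exists a; split=> //; last exact: fa tt.
by split=> // i ij; case: nseg; exists i.
Qed.

(** If [j] were the last index, [approx_meets] with [h] the last function would
    produce a point of [A] among the common zeros of all functions. *)
Lemma no_max (j : J) : exists k, lt j k.
Proof.
apply: contrapT => nk; have [x Hx] := H0.
have [|a [Aa [Da fa] fja]] := @approx_meets j (f j) (@fc j).
  by exists x; split; [exact: residue_approx|exact: Hx.2].
apply: (HA Aa); split=> // i; have [ij|->//|ji] := wo_tri wo i j; first exact: fa.
by case: nk; exists i.
Qed.

Lemma approx_meets_cst (j : J) : exists a, A a /\ approx j a.
Proof.
have [x Hx] := H0; have [||a [Aa ja _]] := @approx_meets j (fun=> 0).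
- by move=> y; exact: cvg_cst.
- by exists x; split=> //; exact: residue_approx.
- by exists a.
Qed.

Lemma J_inhabited : inhabited J.
Proof.
apply: contrapT => nJ; have [x [Dx _]] := H0.
have nb : ~ escape R A J.
  apply: (not_escape_countable cX Aw); exists (fun=> 0%N) => j.
  by case: nJ; exact: inhabits j.
apply: nb; exists D, f; split; [exact: DA|exact: fc| |].
  by exists x; split=> // j; case: nJ; exact: inhabits j.
by move=> [a [Aa Da fa]]; exact: (HA Aa).
Qed.

Lemma approx_cofinal (x : X) :
  (forall j, exists k, ~ lt k j /\ approx k x) -> residue x.
Proof.
move=> h; split; first by have [j] := J_inhabited; have [k [_ []]] := h j.
move=> j; have [j' jj'] := no_max j; have [k [kj' [_ fk]]] := h j'.
apply: fk; have [->//|] := wo_nlt wo kj'.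
exact: wo_trans wo _ _ _ jj'.
Qed.

Lemma approx_sub (h : X -> R) (U : set X) : continuous h -> open U ->
  (forall x, residue x -> h x = 0 -> U x) ->
  exists j, forall x, approx j x -> h x = 0 -> U x.
Proof.
move=> hc oU HU; apply: contrapT => nj.
have [|||x xP] := compact_directed
   (F := fun j => (approx j `&` [set x | h x = 0]) `&` ~` U) cX J_inhabited.
- move=> j; apply: closedI; last exact: open_closedC.
  by apply: closedI; [exact: approx_closed|exact: zero_closed].
- move=> j; apply: contrapT => nx; apply: nj; exists j => x jx hx.
  by apply: contrapT => Ux; apply: nx; exists x.
- move=> i j; have [ij|->|ji] := wo_tri wo i j.
  + exists j; split=> // x [[jx hx] Ux]; split=> //; split=> //.
    by apply: approx_anti jx; right.
  + by exists j; split.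
  + exists i; split=> // x [[jx hx] Ux]; split=> //; split=> //.
    by apply: approx_anti jx; right.
have [j0] := J_inhabited; have [[_ hx] Ux] := xP j0; apply: Ux; apply: HU => //.
by apply: approx_cofinal => j; exists j; split; [exact: wo_irr|case: (xP j) => -[]].
Qed.

(** If [c] were cofinal, points of [A] chosen in the sets [approx (c n)] would
    cluster at a point of [A] that lies in all of them, hence in the residue. *)
Lemma nat_bounded (c : nat -> J) : exists k, forall n, lt (c n) k.
Proof.
apply: contrapT => nk.
have cof k : exists n, ~ lt (c n) k.
  by apply: contrapT => h; apply: nk; exists k => n; apply: contrapT => h'; apply: h; exists n.
have /choice[a aP] n : exists a, A a /\ approx (c n) a by exact: approx_meets_cst.
have cl n m : ~ lt (c m) (c n) -> approx (c n) (a m).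
  move=> mn; have [_ h] := aP m; apply: approx_anti h.
  by have [->|] := wo_nlt wo mn; [left|right].
have [|||y yP] := compact_directed
  (F := fun n => closure [set a m | m in [set m | ~ lt (c m) (c n)]]) cX (inhabits 0%N).
- by move=> n; exact: closed_closure.
- by move=> n; exists (a n); apply: subset_closure; exists n => //=; exact: wo_irr.
- have sub i j : lt (c i) (c j) ->
    closure [set a m | m in [set m | ~ lt (c m) (c j)]] `<=`
    closure [set a m | m in [set m | ~ lt (c m) (c i)]].
    move=> ij; apply: closure_subset; apply: image_subset => m /= mj mi.
    by apply: mj; exact: wo_trans wo _ _ _ mi ij.
  move=> i j; have [ij|ij|ji] := wo_tri wo (c i) (c j).
  + by exists j; split=> //; exact: sub.
  + by exists j; split=> //; rewrite ij.
  + by exists i; split=> //; exact: sub.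
apply: (@HA y).
  apply: (Aw (B := range a)).
  - exact: (sub_countable (card_image_le _ _) (countableP _)).
  - by move=> _ [n _ <-]; case: (aP n).
  - apply: closure_subset (yP 0%N); exact: image_subset.
apply: approx_cofinal => j; have [n nj] := cof j; exists (c n); split=> //.
apply: (approx_closed (j := c n)); apply: closure_subset (yP n) => _ [m /= mn <-].
exact: cl.
Qed.

Lemma countable_bounded (S : set J) : countable S -> exists k, forall i, S i -> lt i k.
Proof.
move=> /countable_lept[g gI]; have [j0] := J_inhabited.
(* Numbers that enumerate no element of [S] are sent to an arbitrary index. *)
pose c n := if pselect (exists i : S, g i = n) is left h then val (projT1 (cid h)) else j0.
have [k kP] := nat_bounded c; exists k => i Si.
suff <- : c (g (SigSub (mem_set Si))) = i by [].
rewrite /c; case: pselect => [h|[]]; last by exists (SigSub (mem_set Si)).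
by case: cid => i' /= /gI ->.
Qed.

End MinimalEscape.

(** * Finite conditions *)

Lemma In_cat (T : Type) (x : T) (s t : seq T) :
  List.In x (s ++ t) <-> List.In x s \/ List.In x t.
Proof. exact: List.in_app_iff. Qed.

Section Conditions.
Context (I : Type).

Definition functional (s : seq (I * bool)) :=
  forall i, List.In (i, true) s -> List.In (i, false) s -> False.

Lemma functional_incl s t : List.incl s t -> functional t -> functional s.
Proof. by move=> st ft i /st h /st; exact: ft h. Qed.

Lemma functionalN s i e : functional s -> List.In (i, e) s -> List.In (i, ~~ e) s -> False.
Proof. by move=> fs; case: e => /= h1 h2; apply: (fs i). Qed.

Lemma not_functional_cat s t : functional s -> functional t ->
  ~ functional (s ++ t) ->
  exists i e, List.In (i, e) t /\ List.In (i, ~~ e) s.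
Proof.
move=> fs ft nf; apply: contrapT => h; apply: nf => i h1 h2.
have [h1s|h1t] := (In_cat _ _ _).1 h1; have [h2s|h2t] := (In_cat _ _ _).1 h2.
- exact: fs h1s h2s.
- by apply: h; exists i, false.
- by apply: h; exists i, true.
- exact: ft h1t h2t.
Qed.

(** Conditions of bounded length over a common part [r] have a finite predense
    subset. Fix one condition [t0]: a condition incompatible with it contains
    the negation of one of the finitely many literals of [t0]; move that literal
    into the common part and the remaining length drops. *)
Lemma finite_predense (n : nat) (r : seq (I * bool)) (T : set (seq (I * bool))) :
  (forall t, T t -> [/\ functional t, List.incl r t &
     exists u, (size u <= n)%N /\ List.incl t (r ++ u)]) ->
  exists B : seq (seq (I * bool)), (forall b, List.In b B -> T b) /\
    forall t, T t -> exists b, List.In b B /\ functional (t ++ b).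
Proof.
elim: n r T => [|n IH] r T Tr.
  have [[t0 Tt0]|nT] := pselect (exists t, T t); last first.
    by exists [::]; split=> // t Tt; case: nT; exists t.
  exists [:: t0]; split=> [b [<-|[]]//|t Tt]; exists t0; split; first by left.
  have [ft0 rt0 _] := Tr _ Tt0; have [_ _ [u [u0 tu]]] := Tr _ Tt.
  apply: (functional_incl _ ft0) => l /In_cat[/tu|//].
  by move: u0; rewrite leqn0 => /nilP ->; rewrite cats0 => /rt0.
have [[t0 Tt0]|nT] := pselect (exists t, T t); last first.
  by exists [::]; split=> // t Tt; case: nT; exists t.
have [ft0 rt0 _] := Tr _ Tt0.
have /choice[B BP] (l : I * bool) : exists B : seq (seq (I * bool)),
    List.In l t0 -> (forall b, List.In b B -> T b) /\
    forall t, T t -> List.In (l.1, ~~ l.2) t ->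
       exists b, List.In b B /\ functional (t ++ b).
  have [lt0|] := pselect (List.In l t0); last by exists [::].
  have [|B [BT BP]] := IH ((l.1, ~~ l.2) :: r)
      [set t | T t /\ List.In (l.1, ~~ l.2) t].
    move=> t [Tt lt]; have [ft rt [u [un tu]]] := Tr _ Tt; split=> //.
      by move=> k [<-//|/rt].
    have [/rt0|lu] := (In_cat _ _ _).1 (tu _ lt).
      by move: lt0; rewrite (surjective_pairing l) /= => h /(functionalN ft0 h).
    have [u1 [u2 uE]] := List.in_split _ _ lu; exists (u1 ++ u2).
    split; first by move: un; rewrite uE !size_cat /= addnS ltnS.
    move=> k /tu /In_cat[kr|]; first by right; apply/In_cat; left.
    rewrite uE => /In_cat[k1|[<-|k2]]; [right|by left|right];
      apply/In_cat; right; apply/In_cat; by auto.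
  exists B => _; split=> [b /BT[]//|t Tt lt]; exact: BP.
exists (t0 :: List.flat_map B t0); split=> [b [<-//|]|t Tt].
  by move=> /(List.in_flat_map _ _ _)[l [/BP[BT _] /BT]].
have [tt0|ntt0] := pselect (functional (t ++ t0)); first by exists t0; split=> //; left.
have [ft _ _] := Tr _ Tt.
have [i [e [it0 it]]] := not_functional_cat ft ft0 ntt0.
have [_ /(_ t Tt it)[b [bB tb]]] := BP _ it0.
by exists b; split=> //; right; apply/(List.in_flat_map _ _ _); exists (i, e).
Qed.

(** The countable chain condition of the forcing with finite partial functions,
    in the form in which it is used: for each [n], the conditions of length at
    most [n] contribute a finite set. *)
Lemma countable_predense (T : set (seq (I * bool))) :
  (forall t, T t -> functional t) ->
  exists B, [/\ countable B, B `<=` T &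
    forall t, T t -> exists2 b, B b & functional (t ++ b)].
Proof.
move=> Tf.
have /choice[B BP] n : exists B : seq (seq (I * bool)),
    (forall b, List.In b B -> T b) /\
    forall t, T t -> (size t <= n)%N -> exists b, List.In b B /\ functional (t ++ b).
  have [|B [BT BP]] := @finite_predense n [::] [set t | T t /\ (size t <= n)%N].
    by move=> t [Tt tn]; split; [exact: Tf|move=> k []|exists t; split].
  by exists B; split=> [b /BT[]//|t Tt tn]; apply: BP.
exists (\bigcup_n [set b | List.In b (B n)]); split.
- apply: bigcup_countable => // n _; elim: (B n) => [|b l IH].
    by rewrite (_ : mkset _ = set0) //; apply/seteqP; split.
  rewrite (_ : mkset _ = [set b] `|` [set b | List.In b l]).
    by rewrite -bigcup2E; apply: bigcup_countable => // -[|[|k]] _ /=.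
  by apply/seteqP; split=> x /= [] => [<-|h|->|h]; auto.
- by move=> b [n _] /(proj1 (BP n)).
- move=> t Tt; have [_ /(_ t Tt (leqnn _))[b [bB tb]]] := BP (size t).
  by exists b => //; exists (size t).
Qed.

Lemma countable_words (S : set I) (Q : set (seq (I * bool))) : countable S ->
  (forall s, Q s -> forall i e, List.In (i, e) s -> S i) -> countable Q.
Proof.
move=> /countable_injP[g gI] QS; apply/countable_injP.
exists (fun s => pickle [seq (g l.1, l.2) | l <- s]) => s t /set_mem Qs /set_mem Qt.
move=> /(pcan_inj pickleK) /=.
elim: s t {Qs Qt} (QS _ Qs) (QS _ Qt) => [|[i e] s IH] [|[j d] t] //= hs ht.
move=> [gij -> est]; have -> : i = j.
  by apply: gI gij; apply: mem_set; [apply: (hs i e)|apply: (ht j d)]; left.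
congr cons; apply: IH est.
- by move=> i' e' h; apply: (hs i' e'); right.
- by move=> i' e' h; apply: (ht i' e'); right.
Qed.

Context (R : realType) (X : topologicalType) (g : I -> X -> R).
Context (gc : forall i, continuous (g i)).

(** The value true of a bit is encoded by [1 <= g i x] and false by
    [g i x <= 0], so that both are closed conditions with a gap between them. *)
Definition lit i (e : bool) (x : X) : Prop := if e then 1 <= g i x else g i x <= 0.

Definition sat (s : seq (I * bool)) (x : X) :=
  forall i e, List.In (i, e) s -> lit i e x.

Lemma sat_incl s t x : List.incl s t -> sat t x -> sat s x.
Proof. by move=> st tx i e /st; exact: tx. Qed.

Definition slack (l : I * bool) (x : X) : R :=
  Num.max 0 (if l.2 then 1 - g l.1 x else g l.1 x).

Lemma slack_continuous l : continuous (slack l).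
Proof.
move=> x; apply: continuous_max; first exact: cvg_cst.
case: l => i [] /=; last exact: gc.
by apply: cvgB; [exact: cvg_cst|exact: gc].
Qed.

Lemma slack_eq0 i e x : slack (i, e) x = 0 <-> lit i e x.
Proof.
rewrite /slack /lit /=; case: e.
  by rewrite -subr_le0; split=> [/max_idPl//|/max_idPl].
by split=> [/max_idPl//|/max_idPl].
Qed.

(** A finite condition is the zero set of one continuous function; this is how
    conditions become available to [approx_meets]. *)
Definition slacks (s : seq (I * bool)) : X -> R :=
  foldr (fun l h x => `|slack l x| + `|h x|) (fun=> 0) s.

Lemma slacks_continuous s : continuous (slacks s).
Proof.
elim: s => [|l s IH] /=; first by move=> x; exact: cvg_cst.
by apply: continuous_absD => //; exact: slack_continuous.
Qed.

Lemma slacks_eq0 s x : slacks s x = 0 <-> sat s x.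
Proof.
elim: s => [|[i e] s IH] /=; first by split=> // _ i e [].
rewrite absD_eq0 IH slack_eq0; split=> [[h hs] i' e' [[<- <-]//|]|h].
  exact: hs.
by split; [apply: h; left|move=> i' e' h'; apply: h; right].
Qed.

End Conditions.

(** * Points of the set near a point where the conditions are dense *)

(** The sets [C j] and [H] stand for those of a minimal escape, the functions [g]
    and the conditions [P] for a stage of the recursion at which the conditions
    are dense at [p]. *)
Section Density.
Context (R : realType) (X : topologicalType) (A : set X).
Context (cX : compact [set: X]) (Aw : omega_closed A).
Context (J : Type) (lt : J -> J -> Prop) (wo : wellorder lt).
Context (C : J -> set X) (H : set X).
Context (Cmeets : forall j (h : X -> R), continuous h ->
  (exists x, C j x /\ h x = 0) -> exists a, [/\ A a, C j a & h a = 0]).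
Context (Csub : forall (h : X -> R) U, continuous h -> open U ->
  (forall x, H x -> h x = 0 -> U x) ->
  exists j, forall x, C j x -> h x = 0 -> U x).
Context (Canti : forall i j, i = j \/ lt i j -> C j `<=` C i).
Context (HC : forall j, H `<=` C j).
Context (Cbdd : forall S, countable S -> exists k, forall i, S i -> lt i k).

Context (I : Type) (g : I -> X -> R) (gc : forall i, continuous (g i)).
Context (P : set (seq (I * bool))) (P0 : P [::]).
Context (Pcat : forall s t, P s -> P t -> functional (s ++ t) -> P (s ++ t)).
Context (Pfun : forall s, P s -> functional s).
Context (S : set I) (PS : forall s, P s -> forall i b, List.In (i, b) s -> S i).
Context (Pne : forall s, P s -> exists x, H x /\ sat g s x).
Context (p : X) (Hp : H p).
Context (dense : forall U, open U -> U p ->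
  exists s, P s /\ forall x, H x -> sat g s x -> U x).

Definition inside (U : set X) := [set s | P s /\ forall x, H x -> sat g s x -> U x].

Lemma predense_choice : exists B : set X -> set (seq (I * bool)), forall U,
  [/\ countable (B U), B U `<=` inside U &
    forall t, inside U t -> exists2 b, B U b & functional (t ++ b)].
Proof.
have /choice[B BP] U : exists B, [/\ countable B, B `<=` inside U &
    forall t, inside U t -> exists2 b, B b & functional (t ++ b)].
  by apply: countable_predense => t [/Pfun].
by exists B.
Qed.

Context (B : set X -> set (seq (I * bool))).
Context (BP : forall U, [/\ countable (B U), B U `<=` inside U &
    forall t, inside U t -> exists2 b, B U b & functional (t ++ b)]).

(** At level [j], the countable set [Q] of conditions already governs the
    neighbourhood [U]: the predense conditions belong to [Q] and confine their
    solutions to [U] even in [C j], not only in [H]. *)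
Definition settled (j : J) (Q : set (seq (I * bool))) (U : set X) :=
  [/\ open U, U p, B U `<=` Q & forall b, B U b -> forall x, C j x -> sat g b x -> U x].

(** For finitely many settled neighbourhoods there is a condition in [Q] that
    extends a predense condition of each: take [s0] forcing into their
    intersection and extend it successively, discarding [s0] at the end. Thus
    the closures of the corresponding sets of points of [A] are centered, and a
    common point lies in [A] because [Q] is countable. *)
Lemma density_point (j : J) (Q : set (seq (I * bool))) :
  countable Q -> Q `<=` P -> Q [::] ->
  (forall s t, Q s -> Q t -> functional (s ++ t) -> Q (s ++ t)) ->
  exists q, A q /\ forall U, settled j Q U -> closure U q.
Proof.
move=> cQ QP Q0 Qcat.
have /choice[a aP] s : exists a, P s -> [/\ A a, C j a & sat g s a].
  have [Ps|] := pselect (P s); last by exists p.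
  have [|a [Aa ja sa]] := Cmeets (j := j) (slacks_continuous gc (s:=s)).
    by have [x [Hx sx]] := Pne Ps; exists x; split; [exact: HC|apply/slacks_eq0].
  by exists a => _; split=> //; apply/slacks_eq0.
pose E U := closure [set a s | s in [set s | Q s /\ exists2 b, B U b & List.incl b s]].
pose F : set (set X) := [set V | V = closure [set a s | s in Q] \/
  exists2 U, settled j Q U & V = E U].
have [V [->|[U _ ->]]|l lF|q qF] := compact_centered (C := F) cX;
    [exact: closed_closure|exact: closed_closure| |].
  (* [W] lies in all the neighbourhoods that occur in [l]. *)
  have [W [oW Wp lW]] : exists W, [/\ open W, W p & forall V, List.In V l ->
      V = closure [set a s | s in Q] \/
      exists U, [/\ settled j Q U, V = E U & W `<=` U]].
    elim: l lF => [_|V l IH lF]; first by exists setT; split=> //; exact: openT.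
    have [|W [oW Wp lW]] := IH; first by move=> V' V'l; apply: lF; right.
    have [->|[U sU VE]] := lF V (or_introl erefl).
      by exists W; split=> // V' [<-|/lW]; [left|].
    exists (W `&` U); have [oU Up _ _] := sU; split=> //; first exact: openI.
    move=> V' [<-|/lW[|[U' [sU' E' WU']]]]; [right|by left|right].
      by exists U; split=> // x [].
    by exists U'; split=> // x [/WU'].
  have [s0 [Ps0 s0W]] := dense oW Wp.
  (* [r] stays in [Q]; its compatibility with [s0], which forces into every [U],
     makes a compatible predense condition for the next [U] available. *)
  have [r [Qr s0r rl]] : exists r, [/\ Q r, functional (s0 ++ r) &
      forall V, List.In V l -> forall r', Q r' -> List.incl r r' -> V (a r')].
    elim: l lW {lF} => [_|V l IH lW].
      by exists [::]; split=> //; rewrite cats0; exact: Pfun.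
    have [|r [Qr s0r rl]] := IH; first by move=> V' V'l; apply: lW; right.
    have [VE|[U [sU VE WU]]] := lW V (or_introl erefl).
      exists r; split=> // V' [<-|/rl//] r' Qr' _; rewrite VE.
      by apply: subset_closure; exists r'.
    have [cB Bin Bpre] := BP U; have [oU Up BQ _] := sU.
    have [|b Bb s0rb] := Bpre (s0 ++ r).
      split; first by apply: Pcat => //; exact: QP.
      move=> x Hx s0rx; apply: WU; apply: s0W => //; apply: sat_incl s0rx.
      by move=> k kl; apply/In_cat; left.
    have rb : functional (r ++ b).
      apply: functional_incl s0rb => k /In_cat[kl|kl]; apply/In_cat; last by right.
      by left; apply/In_cat; right.
    exists (r ++ b); split.
    - by apply: Qcat => //; exact: BQ.
    - by move: s0rb; rewrite catA.
    - move=> V' [<-|V'l] r' Qr' rr'.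
        rewrite VE; apply: subset_closure; exists r' => //; split=> //.
        by exists b => // k kb; apply: rr'; apply/In_cat; right.
      by apply: rl V'l _ Qr' _ => k kr; apply: rr'; apply/In_cat; left.
  by exists (a r) => V /rl; apply.
exists q; split.
  apply: (Aw (B := [set a s | s in Q])).
  - exact: (sub_countable (card_image_le _ _) cQ).
  - by move=> _ [s /QP/aP[Aa _ _] <-].
  - by apply: qF; left.
move=> U sU; have : E U q by apply: qF; right; exists U.
apply: closure_subset => _ [s [Qs [b Bb bs]] <-].
have [_ _ _ BU] := sU; have [_ ja sa] := aP _ (QP _ Qs).
by apply: BU Bb _ ja _; exact: sat_incl sa.
Qed.

(** Each of the countably many predense conditions is confined to [U] from some
    level on, and countably many levels are bounded. *)
Lemma settled_bound (U : set X) : open U -> exists k, forall j, ~ lt j k ->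
  forall b, B U b -> forall x, C j x -> sat g b x -> U x.
Proof.
move=> oU; have [cB Bin _] := BP U.
have /choice[jj jjP] b : exists j, B U b -> forall x, C j x -> sat g b x -> U x.
  have [Bb|nB] := pselect (B U b); last by have [k _] := Cbdd (countable0 J); exists k.
  have [|j jP] := Csub (slacks_continuous gc (s:=b)) oU.
    by move=> x Hx /slacks_eq0 bx; have [_] := Bin b Bb; exact.
  by exists j => _ x jx bx; apply: jP => //; apply/slacks_eq0.
have [k kP] := Cbdd (sub_countable (card_image_le jj (B U)) cB).
exists k => j jk b Bb x jx bx; apply: jjP (Bb) _ _ bx; apply: Canti jx.
right; have [->|kj] := wo_nlt wo jk; first by apply: kP; exists b.
by apply: wo_trans wo _ _ _ _ kj; apply: kP; exists b.
Qed.

Context (W : Type) (ltW : W -> W -> Prop) (woW : wellorder ltW).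
Context (Wbdd : forall S, countable S -> exists k, forall i, S i -> ltW i k).
Context (e : I -> W) (ce : forall w, countable [set i | S i /\ ltW (e i) w]).

(** An increasing chain of countable sets of conditions. *)
Definition words (w : W) : set (seq (I * bool)) :=
  [set s | P s /\ forall i b, List.In (i, b) s -> ltW (e i) w].

Lemma words_bound (U : set X) : exists k, forall w, ~ ltW w k -> B U `<=` words w.
Proof.
have [cB Bin _] := BP U.
pose T := \bigcup_(s in B U) [set w | exists i b, e i = w /\ List.In (i, b) s].
have [|k kP] := Wbdd (S := T).
  apply: bigcup_countable => // s _; elim: s => [|[i b] s IH].
    by rewrite (_ : mkset _ = set0) //; apply/seteqP; split=> // w [i [b []]].
  rewrite (_ : mkset _ =
      [set e i] `|` [set w | exists i b, e i = w /\ List.In (i, b) s]).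
    by rewrite -bigcup2E; apply: bigcup_countable => // -[|[|k]] _ /=.
  apply/seteqP; split=> w /=.
    by move=> [i' [b' [<- [[<- _]|h]]]]; [left|right; exists i', b'].
  by move=> [->|[i' [b' [<- h]]]]; [exists i, b; auto|exists i', b'; auto].
exists k => w wk s Bs; split; first by have [] := Bin s Bs.
move=> i b h; have ik : ltW (e i) k by apply: kP; exists s => //; exists i, b.
by have [->//|] := wo_nlt woW wk; exact: wo_trans woW _ _ _ ik.
Qed.

Lemma density_points : exists q : J -> W -> X, (forall j w, A (q j w)) /\
  forall U, open U -> U p -> exists k l, forall j w,
    ~ lt j k -> ~ ltW w l -> closure U (q j w).
Proof.
have /choice[q qP] (jw : J * W) : exists q, A q /\
    forall U, settled jw.1 (words jw.2) U -> closure U q.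
  apply: density_point.
  - apply: (countable_words (ce jw.2)) => s [Ps h] i b si.
    by split; [exact: PS si|exact: h si].
  - by move=> s [].
  - by split.
  - move=> s t [Ps hs] [Pt ht] fst; split; first exact: Pcat.
    by move=> i b /In_cat[/hs|/ht].
exists (fun j w => q (j, w)); split=> [j w|U oU Up]; first by case: (qP (j, w)).
have [k kP] := settled_bound oU; have [l lP] := words_bound U.
exists k, l => j w jk wl; have [_] := qP (j, w); apply; split=> //=.
- exact: lP.
- exact: kP.
Qed.

End Density.

(** * Conditions are dense at no point *)

Lemma uncountable_bounded (W : Type) (lt : W -> W -> Prop) : wellorder lt ->
  (forall w, lept [set w' | lt w' w] nat) -> ~ lept W nat ->
  forall S, countable S -> exists k, forall i, S i -> lt i k.
Proof.
move=> wo cseg Wunc S cS; apply: contrapT => nk; apply: Wunc.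
apply/countableT_lept.
rewrite (_ : [set: W] = \bigcup_(i in S) [set w' | lt w' i \/ w' = i]).
  by apply: bigcup_countable => // i _; apply/countable_lept/lept_le_segment.
apply/seteqP; split=> // w _; apply: contrapT => nw; apply: nk; exists w => i Si.
by have [//|iw|wi] := wo_tri wo i w; case: nw; exists i => //=; [right|left].
Qed.

Lemma wo_max (W : Type) (lt : W -> W -> Prop) (k l : W) : wellorder lt ->
  exists m, (forall j, lt j k -> lt j m) /\ (forall j, lt j l -> lt j m).
Proof.
move=> wo; have [kl|->|lk] := wo_tri wo k l.
- by exists l; split=> // j jk; exact: wo_trans wo _ _ _ jk kl.
- by exists l.
- by exists k; split=> // j jl; exact: wo_trans wo _ _ _ jl lk.
Qed.

Lemma closed_nbhs_sub (X : topologicalType) (p : X) (U : set X) :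
  compact [set: X] -> hausdorff_space X -> nbhs p U ->
  exists V, [/\ open V, V p & closure V `<=` U].
Proof.
move=> cX hX Up; have [V Vp VU] := compact_regular hX cX filterT Up.
exists V°; split; first exact: open_interior.
- exact: nbhs_singleton (nbhs_interior Vp).
- apply: subset_trans VU; apply: closure_subset; exact: interior_subset.
Qed.

(** The hypotheses say that [L] is ordered like the first uncountable ordinal. *)
Section Clustering.
Context (R : realType) (X : topologicalType) (A : set X).
Context (cX : compact [set: X]) (hX : hausdorff_space X) (Aw : omega_closed A).
Context (L : Type) (ltL : L -> L -> Prop) (woL : wellorder ltL).
Context (csegL : forall w, lept [set w' | ltL w' w] nat).
Context (Lunc : ~ lept L nat).

(** The set [Q] of cluster points of [u] is closed. If it missed [A], it would be
    disjoint from the closure of every initial part of [u], which lies in [A];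
    functions separating it from these closures would be an escape of size [L]
    from the range of [u]. *)
Lemma not_escape_clusters (u : L -> X) : ~ escape R A L -> (forall w, A (u w)) ->
  exists y, A y /\ forall w, closure [set u w' | w' in [set w' | ~ ltL w' w]] y.
Proof.
move=> nb Au; apply: contrapT => ny; apply: nb.
pose T w := closure [set u w' | w' in [set w' | ~ ltL w' w]].
pose Q := \bigcap_w T w.
pose I w := closure [set u w' | w' in [set w' | ltL w' w]].
have QI w : I w `&` Q = set0.
  apply/seteqP; split=> // x [Ix Qx]; apply: ny; exists x; split; last first.
    by move=> v; exact: Qx.
  apply: (Aw (B := [set u w' | w' in [set w' | ltL w' w]])) Ix.
    by apply: (sub_countable (card_image_le _ _)); exact/countable_lept.
  by move=> _ [v _ <-].
have Qcl : closed Q by apply: closed_bigI => w _; exact: closed_closure.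
have nX : normal_space X by exact: compact_normal.
have sep w : uniform_separator (I w) Q.
  by apply: normal_uniform_separator => //; exact: closed_closure.
pose f w : X -> R := fun x => 1 - Urysohn (I w) Q x.
have fQ w x : Q x -> f w x = 0.
  move=> Qx; have /(_ (Urysohn (I w) Q x)) := Urysohn_sub1 (R := R) (sep w).
  by rewrite /f => ->; [rewrite subrr|exists x].
have fI w x : I w x -> f w x <> 0.
  move=> Ix; have /(_ (Urysohn (I w) Q x)) := Urysohn_sub0 (R := R) (sep w).
  by rewrite /f => ->; [rewrite subr0 => /eqP; rewrite oner_eq0|exists x].
exists (range u), f; split.
- by move=> _ [w _ <-].
- move=> w x; apply: cvgB; [exact: cvg_cst|exact: Urysohn_continuous].
- have [l0] : inhabited L.
    apply: contrapT => nL; apply: Lunc; exists (fun=> 0%N) => l.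
    by case: nL; exact: inhabits l.
  have [|||x xT] := compact_directed (F := T) cX (inhabits l0).
  + by move=> w; exact: closed_closure.
  + by move=> w; exists (u w); apply: subset_closure; exists w => //=; exact: wo_irr.
  + have sub i j : ltL i j -> T j `<=` T i.
      move=> ij; apply: closure_subset; apply: image_subset => m /= mj mi.
      by apply: mj; exact: wo_trans woL _ _ _ mi ij.
    move=> i j; have [ij|->|ji] := wo_tri woL i j.
    * by exists j; split=> //; exact: sub.
    * by exists j; split.
    * by exists i; split=> //; exact: sub.
  exists x; split; last by move=> w; apply: fQ => v _; exact: xT.
  by apply: closure_subset (xT l0); exact: image_subset.
- move=> [a [Aa ra fa]]; apply: ny; exists a; split=> // w.
  have : closure ([set u w' | w' in [set w' | ltL w' w]] `|`
                  [set u w' | w' in [set w' | ~ ltL w' w]]) a.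
    apply: closure_subset ra => _ [v _ <-].
    by have [vw|vw] := pselect (ltL v w); [left|right]; exists v.
  by rewrite closureU => -[/fI|//]; rewrite fa.
Qed.

End Clustering.

Section NoDensePoint.
Context (R : realType) (X : topologicalType) (A : set X).
Context (cX : compact [set: X]) (hX : hausdorff_space X) (Aw : omega_closed A).
Context (Ar : radially_closed A).
Context (J : Type) (lt : J -> J -> Prop) (wo : wellorder lt).
Context (Jmin : forall (j : J) (L : Type),
  lept L [set i | lt i j] -> ~ escape R A L).
Context (Jinit : forall j : J, ~ lept J [set i | lt i j]).
Context (D : set X) (f : J -> X -> R) (DA : D `<=` A).
Context (fc : forall j, continuous (f j)).
Context (H0 : exists x, residue D f x) (HA : forall a, A a -> ~ residue D f a).

(** An initial segment of [J] is smaller than [J], so convergence along the order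
    of [J] is convergence in the sense of cardinals. *)
Lemma no_radial_limit (q : J -> X) (p : X) : (forall j, A (q j)) -> ~ A p ->
  (forall U, open U -> U p -> exists k, forall j, ~ lt j k -> closure U (q j)) ->
  False.
Proof.
move=> Aq nAp qp; apply: Ar; exists J, q, p; split=> //.
  move=> fJ; have [k kP] := countable_bounded cX Aw wo Jmin DA fc H0 HA
    (finite_set_countable fJ).
  exact: (wo_irr wo (kP k I)).
move=> U /(closed_nbhs_sub cX hX)[V [oV Vp VU]]; have [k kP] := qp V oV Vp.
split; first exact: subset_card_le.
move=> /card_le_lept h; apply: (@Jinit k).
apply: (lept_trans (lept_into (A := [set: J]) (f := id) _ _)) => //.
apply: (lept_trans h); apply: lept_subset => j /= nUj; apply: contrapT => jk.
by apply: nUj; apply: VU; exact: kP.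
Qed.

Context (L : Type) (ltL : L -> L -> Prop) (woL : wellorder ltL).
Context (csegL : forall w, lept [set w' | ltL w' w] nat).
Context (Lunc : ~ lept L nat).
Context (Lmin : forall M : Type, ~ lept M nat -> lept L M).
Context (I : Type) (g : I -> X -> R) (gc : forall i, continuous (g i)).
Context (P : set (seq (I * bool))) (P0 : P [::]).
Context (Pcat : forall s t, P s -> P t -> functional (s ++ t) -> P (s ++ t)).
Context (Pfun : forall s, P s -> functional s).
Context (S : set I) (PS : forall s, P s -> forall i b, List.In (i, b) s -> S i).
Context (SL : lept S L).
Context (Pne : forall s, P s -> exists x, residue D f x /\ sat g s x).

(** Pull the segments of [ltW] back along the injection of [S]; indices outside
    [S] go to an arbitrary place. *)
Lemma index_map (W : Type) (ltW : W -> W -> Prop) : inhabited W ->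
  (forall w, lept [set w' | ltW w' w] nat) -> lept S W ->
  exists e : I -> W, forall w, countable [set i | S i /\ ltW (e i) w].
Proof.
move=> [w0] cW [h hI].
pose e i := if pselect (S i) is left Si then h (SigSub (mem_set Si)) else w0.
have eE (i : S) : e (val i) = h i.
  rewrite /e; case: pselect => [Si|[]]; last exact: (set_valP i).
  by congr h; exact: val_inj.
exists e => w; apply/countable_lept; apply: lept_trans (cW w).
pose v (i : [set i | S i /\ ltW (e i) w]) : S := SigSub (mem_set (proj1 (set_valP i))).
apply: (lept_into (f := fun i => h (v i))) => [x y /hI/(congr1 val)/= /val_inj//|i].
by have := proj2 (set_valP i); rewrite (_ : val i = val (v i)) // eE.
Qed.

(** When all segments of [J] are countable, [J] itself indexes the chain of
    countable sets of conditions and the diagonal converges. Otherwise the chain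
    is indexed by [L] and each row is replaced by one of its cluster points. *)
Lemma no_dense_point (p : X) : residue D f p ->
  (forall U, open U -> U p ->
     exists s, P s /\ forall x, residue D f x -> sat g s x -> U x) -> False.
Proof.
move=> Hp dense.
have nAp : ~ A p by move=> /HA.
have Cbdd := countable_bounded cX Aw wo Jmin DA fc H0 HA.
have Junc : ~ lept J nat.
  move=> /countableT_lept/Cbdd[k kP]; exact: (wo_irr wo (kP k Logic.I)).
have [B BP] := predense_choice (residue D f) g Pfun.
have pts := density_points cX Aw wo (C := approx lt D f) (H := residue D f)
  (@approx_meets _ _ _ cX Aw _ _ Jmin _ _ DA fc)
  (@approx_sub _ _ _ cX Aw _ _ wo Jmin _ _ DA fc H0 HA)
  (@approx_anti _ _ _ _ wo D f) (@residue_approx _ _ _ lt D f) Cbdd gc P0 Pcat Pfun PS Pne dense BP.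
have [small|[j0 big]] : (forall j, lept [set i | lt i j] nat) \/
    (exists j, ~ lept [set i | lt i j] nat).
- have [h|h] := pselect (exists j, ~ lept [set i | lt i j] nat); [by right|left].
  by move=> j; apply: contrapT => nj; apply: h; exists j.
- have [e ce] := index_map (J_inhabited cX Aw DA fc H0 HA) small
    (lept_trans SL (Lmin Junc)).
  have [q [Aq qP]] := pts J lt wo Cbdd e ce.
  apply: (no_radial_limit (q := fun j => q j j) (p := p)) => // U oU Up.
  have [k [l kl]] := qP U oU Up; have [m [km lm]] := wo_max k l wo.
  by exists m => j jm; apply: kl => h; apply: jm; [exact: km|exact: lm].
- have Wbdd := uncountable_bounded woL csegL Lunc.
  have nbL : ~ escape R A L := Jmin (Lmin big).
  have [l0 _] := Wbdd _ (countable0 L).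
  have [e ce] := index_map (inhabits l0) csegL SL.
  have [q [Aq qP]] := pts L ltL woL Wbdd e ce.
  have /choice[y yP] j := not_escape_clusters cX hX Aw woL csegL Lunc nbL (Aq j).
  apply: (no_radial_limit (q := y) (p := p)) => // [j|U oU Up]; first by case: (yP j).
  have [k [l kl]] := qP U oU Up; exists k => j jk.
  have [_ /(_ l)] := yP j.
  rewrite closureE => /(_ (closure U)); apply; split; first exact: closed_closure.
  by move=> _ [w wl <-]; exact: kl.
Qed.

End NoDensePoint.

(** * Pressing down *)

Section PressingDown.
Context (L : Type) (nL : lept nat L) (LL : lept (L * L) L).

Lemma lept_setU (T : Type) (A B : set T) : lept A L -> lept B L ->
  lept (A `|` B) L.
Proof.
move=> AL BL; rewrite -bigcup2E; apply: lept_bigcup => //.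
  exact: lept_trans (lept_set _) nL.
move=> [|[|n]] _ //=; apply: lept_trans nL.
by apply/countable_lept; exact: countable0.
Qed.

Lemma lept_set1 (T : Type) (x : T) : lept [set x] L.
Proof. by apply: lept_trans nL; apply/countable_lept. Qed.

Lemma lept_words (T : Type) (S : set T) : lept S L ->
  lept [set s : seq (T * bool) | forall i e, List.In (i, e) s -> S i] L.
Proof.
move=> [h hI]; have [c _] := nL; pose l0 := c 0%N.
pose g i := if pselect (S i) is left Si then h (SigSub (mem_set Si)) else l0.
have gI i j : S i -> S j -> g i = g j -> i = j.
  rewrite /g; case: pselect => // Si _; case: pselect => // Sj _.
  by move=> /hI/(congr1 val).
pose code (s : seq (T * bool)) := [seq (g l.1, l.2) | l <- s].
have codeI u v : (forall i e, List.In (i, e) u -> S i) ->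
    (forall i e, List.In (i, e) v -> S i) -> code u = code v -> u = v.
  elim: u v => [|[i e] u IH] [|[j d] v] //= hs ht [gij -> est].
  have -> : i = j by apply: gI gij; [apply: (hs i e)|apply: (ht j d)]; left.
  congr cons; apply: IH est.
  - by move=> i' e' h'; apply: (hs i' e'); right.
  - by move=> i' e' h'; apply: (ht i' e'); right.
apply: (@lept_trans (seq (L * bool))).
  exists (fun s => code (val s)) => s t est; apply: val_inj.
  by apply: codeI est; [exact: (set_valP s)|exact: (set_valP t)].
apply: lept_seq => //; apply: lept_trans LL; apply: lept_mul (lept_refl _) _.
by apply: lept_trans nL; apply/countableT_lept; exact: countableP.
Qed.

Context (M : Type) (lt : M -> M -> Prop) (wo : wellorder lt).
Context (seg : forall w, lept [set w' | lt w' w] L) (ML : ~ lept M L).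

(** The regressive function takes finite sets as values. If every fibre were of
    size at most [L], a set [Y] of size [L], closed downwards and under the
    fibres of all words over it, would be a proper initial segment, and the least
    element outside of [Y] would lie in the fibre of a word over [Y]. *)
Lemma pressing_down (r : M -> seq (M * bool)) :
  (forall m i e, List.In (i, e) (r m) -> lt i m) ->
  exists s, ~ lept [set m | r m = s] L.
Proof.
move=> rlt; apply: contrapT => ns.
have small s : lept [set m | r m = s] L.
  by apply: contrapT => h; apply: ns; exists s.
pose W (S : set M) := [set s : seq (M * bool) | forall i e, List.In (i, e) s -> S i].
pose le m := [set k | lt k m] `|` [set m].
pose Y := fix Y n : set M := if n is k.+1 then
  Y k `|` \bigcup_(s in W (Y k)) \bigcup_(m in [set m | r m = s]) le m else set0.
have YL n : lept (Y n) L.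
  elim: n => [|n IH] /=.
    by apply: lept_trans nL; apply/countable_lept; exact: countable0.
  apply: lept_setU => //; apply: lept_bigcup => //; first exact: lept_words.
  move=> s _; apply: lept_bigcup => // m _; apply: lept_setU => //.
  exact: lept_set1.
have Ydown n k m : lt k m -> Y n m -> Y n k.
  elim: n k m => [//|n IH] k m km /= [/(IH _ _ km)|]; first by left.
  move=> [s Ws [v rv mv]]; right; exists s => //; exists v => //; left.
  by case: mv => [mv|<-//]; exact: wo_trans wo _ _ _ km mv.
have Ymono n m : (n <= m)%N -> Y n `<=` Y m.
  move=> /subnK <-; elim: (m - n)%N => [//|k IH]; rewrite addSn => x /IH.
  by left.
have UL : lept (\bigcup_n Y n) L.
  by apply: lept_bigcup => //; exact: lept_trans (lept_set _) nL.
have [|d nd dmin] := wo_min wo (P := fun m => ~ (\bigcup_n Y n) m).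
  apply: contrapT => h; apply: ML; apply: lept_trans UL.
  apply: (lept_into (f := id)) => // m; apply: contrapT => nm; apply: h.
  by exists m.
have [n nW] : exists n, W (Y n) (r d).
  have : forall i e, List.In (i, e) (r d) -> (\bigcup_n Y n) i.
    by move=> i e /rlt/dmin/contrapT.
  elim: (r d) => [_|[j b] s IH h]; first by exists 0%N => i e [].
  have [|n nW] := IH; first by move=> i e ie; apply: (h i e); right.
  have [m _ mj] := h j b (or_introl erefl).
  exists (maxn n m) => i e [[<- _]|/nW h'].
    exact: Ymono (leq_maxr _ _) _ mj.
  exact: Ymono (leq_maxl _ _) _ h'.
apply: nd; exists n.+1 => //; right; exists (r d) => //.
by exists d => //; right.
Qed.

End PressingDown.

(** * Independent functions by transfinite recursion *)

(** A literal with index [i] may be used only below the condition [ss i] under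
    which the function with index [i] is known to split. *)
Definition admissible (I : Type) (ss : I -> seq (I * bool)) (s : seq (I * bool)) :=
  functional s /\ forall i e, List.In (i, e) s -> List.incl (ss i) s.

Lemma admissible_cat I ss (s t : seq (I * bool)) : admissible ss s ->
  admissible ss t -> functional (s ++ t) -> admissible ss (s ++ t).
Proof.
move=> [_ hs] [_ ht] fst; split=> // i e /In_cat[/hs|/ht] h l /h lst;
  by apply/In_cat; auto.
Qed.

Lemma admissible_nil I ss : admissible ss ([::] : seq (I * bool)).
Proof. by split. Qed.

Section Splitting.
Context (R : realType) (X : topologicalType).
Context (cX : compact [set: X]) (hX : hausdorff_space X).
Context (H : set X) (Hcl : closed H).

(** The threshold 0 lies strictly between the value at [p] and the value outside
    of [U], as required by the encoding of bits. *)
Lemma separating_function (p : X) (U : set X) : open U -> U p ->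
  exists f : X -> R, [/\ continuous f, f p < 0 & forall x, ~ U x -> 1 <= f x].
Proof.
move=> oU Up; have nX : normal_space X by exact: compact_normal.
have sep : uniform_separator [set p] (~` U).
  apply: normal_uniform_separator => //.
  - exact: accessible_closed_set1 (hausdorff_accessible hX) p.
  - exact: open_closedC.
  - by apply/seteqP; split=> // x [-> /(_ Up)].
exists (fun x => 2 * Urysohn [set p] (~` U) x - 1); split.
- move=> x; apply: cvgB; last exact: cvg_cst.
  apply: cvgM; [exact: cvg_cst|exact: Urysohn_continuous].
- have /(_ (Urysohn [set p] (~` U) p)) := Urysohn_sub0 (R := R) sep.
  by move=> ->; [rewrite mulr0 sub0r ltrN10|exists p].
- move=> x nUx; have /(_ (Urysohn [set p] (~` U) x)) := Urysohn_sub1 (R := R) sep.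
  by move=> ->; [rewrite mulr1 addrK|exists x].
Qed.

Context (I : Type) (g : I -> X -> R) (P : set (seq (I * bool))).
Context (P0 : P [::]) (Pne : forall s, P s -> exists x, H x /\ sat g s x).

(** Every [p] in [H] has a function [F p] that is negative at [p] and reaches 1 in
    the solution set of every condition. Finitely many of the sets [F p < 0] cover
    [H]. If [F p] takes no negative value in the solution set of some condition
    [s2], then below [s2] the other members of the cover suffice; after finitely
    many such steps some [F p] splits everything below the current condition. *)
Lemma splitting_function :
  ~ (exists p, H p /\ forall U, open U -> U p ->
     exists s, P s /\ forall x, H x -> sat g s x -> U x) ->
  exists s0 (f : X -> R), [/\ P s0, continuous f &
    forall (b : bool) s, P s -> List.incl s0 s ->
      exists x, [/\ H x, sat g s x & if b then 1 <= f x else f x <= 0]].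
Proof.
move=> nd.
have /choice[F FP] p : exists f : X -> R, H p -> [/\ continuous f, f p < 0 &
    forall s, P s -> exists x, [/\ H x, sat g s x & 1 <= f x]].
  have [Hp|] := pselect (H p); last by exists (fun=> 0).
  have [U [oU Up UP]] : exists U, [/\ open U, U p &
      forall s, P s -> exists x, [/\ H x, sat g s x & ~ U x]].
    apply: contrapT => nU; apply: nd; exists p; split=> // U oU Up.
    apply: contrapT => ns; apply: nU; exists U; split=> // s Ps.
    apply: contrapT => nx; apply: ns; exists s; split=> // x Hx sx.
    by apply: contrapT => nUx; apply: nx; exists x.
  have [f [fc fp fU]] := separating_function oU Up; exists f => _; split=> // s Ps.
  by have [x [Hx sx /fU fx]] := UP s Ps; exists x.
pose C : set (set X) := [set G | G = H \/ exists2 p, H p & G = [set x | 0 <= F p x]].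
have [l lC lne] : exists2 l : seq (set X), (forall G, List.In G l -> C G) &
    forall x, ~ (forall G, List.In G l -> G x).
  apply: contrapT => nl; have [_ [->//|[p /FP[Fc _ _] ->]]|l lC|x xC] :=
      compact_centered (C := C) cX.
  - exact: (@preimage_closed _ _ (F p) [set r | 0 <= r]) (fun y _ => Fc y) (@closed_ge _ 0).
  - apply: contrapT => nx; apply: nl; exists l => // x xl; apply: nx.
    by exists x.
  - have Hx : H x by apply: xC; left.
    have : 0 <= F x x by apply: (xC [set y | 0 <= F x y]); right; exists x.
    by have [_ Fx _] := FP x Hx; rewrite leNgt Fx.
(* Generalized for the induction on [l]: below [s1], the members of [l] alone
   still exclude some solution of every condition. *)
suff : forall s1, P s1 -> (forall s, P s -> List.incl s1 s ->
    exists x, [/\ H x, sat g s x & exists2 G, List.In G l & ~ G x]) ->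
    exists s0 (f : X -> R), [/\ P s0, continuous f &
    forall (b : bool) s, P s -> List.incl s0 s ->
      exists x, [/\ H x, sat g s x & if b then 1 <= f x else f x <= 0]].
  move/(_ [::] P0); apply => s Ps _; have [x [Hx sx]] := Pne Ps.
  exists x; split=> //; apply: contrapT => nG; apply: (lne x) => G lG.
  by apply: contrapT => nGx; apply: nG; exists G.
elim: l lC {lne} => [_ s1 Ps1 /(_ s1 Ps1)[//|x [_ _ [G []]]]|G l IH lC s1 Ps1 h].
have [GH|[p Hp GE]] := lC G (or_introl erefl).
  apply: (IH _ s1 Ps1) => [G' G'l|s Ps ss]; first by apply: lC; right.
  have [x [Hx sx [G' [GG'|G'l] nG']]] := h s Ps ss; last first.
    by exists x; split=> //; exists G'.
  by case: nG'; rewrite -GG' GH.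
have [Fc Fp F1] := FP p Hp.
have [[s2 [Ps2 s12 ns2]]|ns2] := pselect (exists s2, [/\ P s2, List.incl s1 s2 &
    ~ exists x, [/\ H x, sat g s2 x & F p x < 0]]).
  apply: (IH _ s2 Ps2) => [G' G'l|s Ps s2s]; first by apply: lC; right.
  have [|x [Hx sx [G' [GG'|G'l] nG']]] := h s Ps; last first.
  - by exists x; split=> //; exists G'.
  - case: ns2; exists x; split=> //; first exact: sat_incl sx.
    by rewrite ltNge; apply/negP => Fx; apply: nG'; rewrite -GG' GE.
  - by move=> k /s12/s2s.
exists s1, (F p); split=> // -[] s Ps s1s; first exact: F1.
apply: contrapT => nx; apply: ns2; exists s; split=> // -[x [Hx sx Fx]].
by apply: nx; exists x; split=> //; exact: ltW.
Qed.

End Splitting.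

Section Recursion.
Context (R : realType) (X : topologicalType).
Context (cX : compact [set: X]) (hX : hausdorff_space X).
Context (H : set X) (Hcl : closed H) (H0 : exists x, H x).
Context (M : Type) (lt : M -> M -> Prop) (wo : wellorder lt).

Let V := (seq (M * bool) * {f : X -> R | continuous f})%type.
Let ss (d : M -> V) i := (d i).1.
Let g (d : M -> V) i := sval (d i).2.

Definition below (d : M -> V) (m : M) : set (seq (M * bool)) :=
  [set s | admissible (ss d) s /\ forall i e, List.In (i, e) s -> lt i m].

(** The requirement on the value [v] chosen at stage [m]: a condition and a
    function that splits all earlier conditions below it. *)
Definition splits (m : M) (d : M -> V) (v : V) :=
  below d m v.1 /\ forall (b : bool) s, below d m s -> List.incl v.1 s ->
    exists x, [/\ H x, sat (g d) s x &
                  if b then 1 <= sval v.2 x else sval v.2 x <= 0].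

Lemma below_ext d d' m s : (forall k, lt k m -> d k = d' k) -> below d m s -> below d' m s.
Proof.
move=> dd' [[fs as_] sm]; split=> //; split=> // i e ie.
by rewrite /ss -dd'; [exact: (as_ i e ie)|exact: (sm i e ie)].
Qed.

Lemma splits_ext m d d' v : (forall k, lt k m -> d k = d' k) ->
  splits m d v -> splits m d' v.
Proof.
move=> dd' [v1 v2]; split; first exact: below_ext v1.
move=> b s sm v1s; have [x [Hx sx vx]] := v2 b s (below_ext (fun k km => esym (dd' k km)) sm) v1s.
exists x; split=> // i e ie; have [_ /(_ i e ie) im] := sm.
by have := sx i e ie; rewrite /lit /g dd'.
Qed.

Lemma top_index (s : seq (M * bool)) : s <> [::] ->
  exists i e, List.In (i, e) s /\ forall k c, List.In (k, c) s -> k = i \/ lt k i.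
Proof.
elim: s => [//|[i e] s IH] _; have [->|/IH] := pselect (s = [::]).
  by exists i, e; split; [left|move=> k c [[-> _]|[]]; left].
move=> [j [d [jd jmax]]]; have [ij|ij|ji] := wo_tri wo i j.
- by exists j, d; split; [right|move=> k c [[<- _]|/jmax]; auto].
- by exists j, d; split; [right|move=> k c [[<- _]|/jmax]; auto].
- exists i, e; split; first by left.
  move=> k c [[<- _]|/jmax[->|kj]]; auto.
  by right; exact: wo_trans wo _ _ _ kj ji.
Qed.

(** Remove the largest index [i]: what is left lies below [i] and contains
    [ss i], so the function with index [i] splits it. *)
Lemma admissible_sat d s : admissible (ss d) s ->
  (forall i e, List.In (i, e) s -> splits i d (d i)) -> exists x, H x /\ sat (g d) s x.
Proof.
move=> [fs as_] good; have [s0|/top_index[i [e [ie imax]]]] := pselect (s = [::]).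
  by have [x Hx] := H0; exists x; split=> //; rewrite s0 => ? ? [].
have [di1 di2] := good _ _ ie.
pose t := List.filter (fun l => `[< lt l.1 i >]) s.
have tP k c : List.In (k, c) t <-> List.In (k, c) s /\ lt k i.
  rewrite /t List.filter_In /=; split=> [[? /asboolP]|[? ?]]; split=> //.
  exact/asboolP.
have it : List.incl (d i).1 t.
  move=> [k c] kc; apply/tP; split; first exact: (as_ _ _ ie).
  by have [_] := di1; apply; exact: kc.
have tb : below d i t.
  split; last by move=> k c /tP[].
  split; first by apply: functional_incl fs => -[k c] /tP[].
  move=> k c /tP[ks ki] [k' c'] h; apply/tP; split; first exact: (as_ _ _ ks).
  have [[_ kk'] _] := good _ _ ks; apply: wo_trans wo _ _ _ _ ki; exact: kk' h.
have [x [Hx tx ix]] := di2 e t tb it; exists x; split=> // k c kc.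
have [ki|ki] := imax _ _ kc; last by apply: tx; apply/tP.
move: kc; rewrite ki => kc; suff -> : c = e by [].
by case: c e ie ix kc {di2} => [] [] // h _ h'; [case: (fs i h' h)|case: (fs i h h')].
Qed.

Context (L : Type) (nL : lept nat L) (LL : lept (L * L) L).
Context (seg : forall w, lept [set w' | lt w' w] L) (ML : ~ lept M L).
Context (nodense : forall d m, (forall k, lt k m -> splits k d (d k)) ->
  ~ exists p, H p /\ forall U, open U -> U p ->
     exists s, below d m s /\ forall x, H x -> sat (g d) s x -> U x).

(** On the stages [m] with a fixed value [s0] of [ss m], all finite extensions of
    [s0] are admissible; compactness passes from finite to arbitrary choices of
    bits. *)
Lemma independent_functions : exists (f : M -> X -> R) (E : set M),
  [/\ forall m, continuous (f m), ~ lept E L &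
    forall b : M -> bool, exists x, forall m, E m -> lit f m (b m) x].
Proof.
have [d dP] : exists d, forall m, splits m d (d m).
  apply: (wf_choice (wo_wf wo)) => [m d d' v|m d good|].
  - exact: splits_ext.
  - have below0 : below d m [::] by split=> //; exact: admissible_nil.
    have [|s0 [f [s0P fc fP]]] :=
        splitting_function cX hX Hcl below0 _ (nodense good).
      by move=> s [sa sm]; apply: admissible_sat sa _ => i e /sm/good.
    by exists (s0, exist _ f fc).
  - by move=> _; split; [exact: [::]|exists (fun=> 0); move=> x; exact: cvg_cst].
have [|s0 Es0] := pressing_down nL LL wo seg ML (r := ss d).
  by move=> m i e; have [[_ h] _] := dP m; exact: h.
exists (g d), [set m | ss d m = s0]; split=> // [m|b].
  exact: (svalP (d m).2).
pose C : set (set X) := [set G | G = H \/ exists2 m, ss d m = s0 &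
  G = [set x | lit (g d) m (b m) x]].
have [_ [->//|[m _ ->]]|l lC|x xC] := compact_centered (C := C) cX; last first.
- by exists x => m Em; apply: (xC [set x | lit (g d) m (b m) x]); right; exists m.
- have [m0 Em0] : exists m, ss d m = s0.
    apply: contrapT => nm; apply: Es0; apply: lept_trans nL.
    apply/countable_lept; rewrite (_ : mkset _ = set0); first exact: countable0.
    by apply/seteqP; split=> // m Em; case: nm; exists m.
  have [s0a s0m] : admissible (ss d) s0 /\
      forall m, ss d m = s0 -> forall i e, List.In (i, e) s0 -> lt i m.
    split; first by have [[h _] _] := dP m0; rewrite -Em0.
    by move=> m Em i e; rewrite -Em; have [[_ h] _] := dP m; exact: h.
  have [k [kE kl]] : exists k : seq M, (forall m, List.In m k -> ss d m = s0) /\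
      forall G, List.In G l -> G = H \/
        exists2 m, List.In m k & G = [set x | lit (g d) m (b m) x].
    elim: l lC => [_|G l IH lC]; first by exists [::]; split.
    have [|k [kE kl]] := IH; first by move=> G' G'l; apply: lC; right.
    have [GH|[m Em GE]] := lC G (or_introl erefl).
      by exists k; split=> // G' [<-|/kl]; [left|].
    exists (m :: k); split=> [m' [<-//|/kE//]|G' [<-|/kl[->|[m' km' ->]]]].
    + by right; exists m; first left.
    + by left.
    + by right; exists m'; first right.
  pose s := s0 ++ [seq (m, b m) | m <- k].
  have kP i e : List.In (i, e) [seq (m, b m) | m <- k] -> List.In i k /\ e = b i.
    by elim: (k) => [//|m k' IH] /= [[<- <-]|/IH[]]; auto.
  have [|x [Hx sx]] := @admissible_sat d s _ (fun i e _ => dP i).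
    split; last first.
      move=> i e /In_cat[h|/kP[/kE -> _]] c cs; apply/In_cat; left => //.
      exact: (s0a.2 _ _ h) c cs.
    move=> i /In_cat[h1|/kP[k1 b1]] /In_cat[h2|/kP[k2 b2]].
    + exact: (s0a.1 i h1 h2).
    + exact: (wo_irr wo (s0m _ (kE _ k2) _ _ h1)).
    + exact: (wo_irr wo (s0m _ (kE _ k1) _ _ h2)).
    + by move: b1; rewrite -b2.
  exists x => G /kl[->//|[m mk ->]]; apply: sx; apply/In_cat; right.
  by elim: (k) mk => [//|m' k' IH] /= [<-|/IH]; auto.
- rewrite /lit; case: (b m).
    exact: (@preimage_closed _ _ (g d m) [set r | 1 <= r]) (fun y _ => svalP (d m).2 y) (@closed_ge _ 1).
  exact: (@preimage_closed _ _ (g d m) [set r | r <= 0]) (fun y _ => svalP (d m).2 y) (@closed_le _ 0).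
Qed.

End Recursion.

(** * From independent functions to the cube *)

Section Products.
Context (K : Type) (Y : K -> topologicalType).

Lemma product_continuous (X : topologicalType) (f : X -> prod_topology Y) :
  (forall k, continuous (fun x => f x k)) -> continuous f.
Proof.
move=> fk x; apply/cvg_sup => k; move: x.
exact: (@continuous_comp_initial _ _ _ (fun h : (forall i, Y i) => h k) f (fk k)).
Qed.

Lemma eval_continuous (k : K) : continuous (fun h : prod_topology Y => h k).
Proof.
move=> h; have : h @[h --> h] --> h by exact: cvg_id.
move=> hh; have /(_ _ k) hk := (cvg_sup _ _ _).1 hh.
move=> U hU.
have ic := @initial_continuous _ _ (fun h : (forall i, Y i) => h k) h U hU.
exact: (hk (fmap_filter _ (nbhs_filter h)) _ ic).
Qed.

End Products.

Section Dyadic.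
Context (R : realType).

Definition half_pow (n : nat) : R := 2^-1 ^+ n.

Lemma half_pow_gt0 n : 0 < half_pow n.
Proof. by rewrite exprn_gt0 // invr_gt0 ltr0n. Qed.

Lemma half_powS n : half_pow n.+1 + half_pow n.+1 = half_pow n.
Proof. by rewrite /half_pow exprS -mulrDl -[X in X + X]mul1r -splitr mul1r. Qed.

Lemma half_pow_small (e : R) : 0 < e -> exists n, half_pow n < e.
Proof.
move=> e0; have h n : half_pow n <= n.+1%:R^-1.
  rewrite /half_pow exprVn lef_pV2 ?posrE ?ltr0n ?exprn_gt0 ?ltr0n //.
  by rewrite -natrX ler_nat ltn_expl.
exists (Num.truncn e^-1); apply: (le_lt_trans (h _)).
rewrite -[ltRHS]invrK ltf_pV2 ?posrE ?invr_gt0 ?ltr0n //.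
exact: Num.Theory.truncnS_gt.
Qed.

Fixpoint dsum (t : nat -> R) (n : nat) : R :=
  if n is k.+1 then dsum t k + t k * half_pow k.+1 else 0.

Definition dval (t : nat -> R) : R := sup (range (dsum t)).

Lemma dsum_bounds t n m : (forall k, 0 <= t k <= 1) ->
  dsum t n <= dsum t m + half_pow m.
Proof.
move=> t01.
have inc k : dsum t k <= dsum t k.+1.
  by rewrite /= lerDl mulr_ge0 ?(ltW (half_pow_gt0 _)) //; case/andP: (t01 k).
have dec k : dsum t k.+1 + half_pow k.+1 <= dsum t k + half_pow k.
  rewrite /= -addrA lerD2l -(half_powS k) lerD2r ler_piMl ?(ltW (half_pow_gt0 _)) //.
  by case/andP: (t01 k).
have incn a b : dsum t a <= dsum t (b + a)%N.
  by elim: b => [//|b IH]; rewrite addSn; exact: le_trans (inc _).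
have decn a b : dsum t (b + a)%N + half_pow (b + a)%N <= dsum t a + half_pow a.
  by elim: b => [//|b IH]; rewrite addSn; exact: le_trans (dec _) IH.
apply: le_trans (incn n m) _; apply: le_trans (decn m n).
by rewrite addnC lerDl ltW ?half_pow_gt0.
Qed.

Lemma dval_bounds t n : (forall k, 0 <= t k <= 1) ->
  dsum t n <= dval t <= dsum t n + half_pow n.
Proof.
move=> t01; have hs : has_sup (range (dsum t)).
  split; first by exists (dsum t 0); exists 0%N.
  by exists (dsum t 0 + half_pow 0) => _ [m _ <-]; exact: dsum_bounds.
apply/andP; split; first by apply: ub_le_sup; [case: hs|exists n].
by apply: ge_sup; [case: hs|move=> _ [m _ <-]; exact: dsum_bounds].
Qed.

Lemma dval01 t : (forall k, 0 <= t k <= 1) -> 0 <= dval t <= 1.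
Proof. by move=> /(dval_bounds 0); rewrite /= add0r /half_pow expr0. Qed.

(** The bounds on partial sums determine a number up to every power of 1/2. *)
Lemma dval_unique t y : (forall k, 0 <= t k <= 1) ->
  (forall n, dsum t n <= y <= dsum t n + half_pow n) -> dval t = y.
Proof.
move=> t01 yP; apply/eqP; rewrite -subr_eq0 -normr_le0 leNgt; apply/negP => h.
have [n nh] := half_pow_small h.
have /andP[a1 a2] := dval_bounds n t01; have /andP[b1 b2] := yP n.
move: nh; rewrite ltNge => /negP; apply; rewrite ler_norml; apply/andP; split.
  by rewrite lerNl opprB lerBlDl (le_trans b2) // lerD2r.
by rewrite lerBlDl (le_trans a2) // lerD2r.
Qed.

Fixpoint greedy (y : R) (n : nat) : R :=
  if n is k.+1 then
    if greedy y k + half_pow k.+1 <= y then greedy y k + half_pow k.+1 else greedy y k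
  else 0.

Lemma binary_expansion (y : R) : 0 <= y <= 1 ->
  exists b : nat -> bool, dval (fun n => (b n)%:R) = y.
Proof.
move=> /andP[y0 y1]; pose b n := greedy y n + half_pow n.+1 <= y.
have sE n : dsum (fun k => (b k)%:R) n = greedy y n.
  elim: n => [//|n IH] /=; rewrite IH {1}/b.
  by case: ifP => _; rewrite ?mul1r ?mul0r ?addr0.
exists b; apply: dval_unique => [k|n]; first by case: (b k); rewrite ?lexx ?ler01.
rewrite sE; elim: n => [|n /andP[IH1 IH2]] /=.
  by rewrite y0 add0r /half_pow expr0 y1.
case: ifPn => [h|]; first by rewrite h -addrA half_powS.
by rewrite -ltNge => h; rewrite IH1 ltW.
Qed.

(** The partial sums approximate the value uniformly. *)
Lemma dval_continuous (X : topologicalType) (t : nat -> X -> R) :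
  (forall n, continuous (t n)) -> (forall n x, 0 <= t n x <= 1) ->
  continuous (fun x => dval (t ^~ x)).
Proof.
move=> tc t01 x.
have sc n : continuous (fun x => dsum (t ^~ x) n).
  elim: n => [|n IH] y /=; first exact: cvg_cst.
  by apply: cvgD; [exact: IH|apply: cvgM; [exact: tc|exact: cvg_cst]].
apply/cvgrPdist_lt => e e0.
have e2 : 0 < e / 2 by rewrite divr_gt0.
have [n ne] := half_pow_small e2.
have := sc n x; move=> /cvgrPdist_lt/(_ _ e2); apply: filterS => y xy.
have /andP[a1 a2] := dval_bounds n (t01 ^~ x).
have /andP[b1 b2] := dval_bounds n (t01 ^~ y).
move: xy; rewrite !ltr_norml => /andP[h1 h2].
apply/andP; split; lra.
Qed.

Definition clip (r : R) : R := Num.min 1 (Num.max 0 r).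

Lemma clip01 r : 0 <= clip r <= 1.
Proof. by rewrite /clip le_min ler01 le_max lexx ge_min lexx. Qed.

Lemma clip_lit (b : bool) r : (if b then 1 <= r else r <= 0) -> clip r = b%:R.
Proof.
rewrite /clip; case: b => h; first by rewrite max_r ?min_l // (le_trans ler01).
by rewrite max_l // min_r.
Qed.

Lemma clip_continuous (X : topologicalType) (f : X -> R) :
  continuous f -> continuous (clip \o f).
Proof.
move=> fc x.
apply: (@continuous_min R X (fun=> 1) (fun y => Num.max 0 (f y))).
  exact: cvg_cst.
by apply: (@continuous_max R X (fun=> 0) f); [exact: cvg_cst|exact: fc].
Qed.

(** Each coordinate of the cube is the value of a binary series whose digits are
    countably many of the clipped functions; distinct coordinates use disjoint
    sets of digits, so all bits can be prescribed simultaneously. *)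
Lemma cube_surjection (X : topologicalType) (M : Type) (f : M -> X -> R)
    (E : set M) (K : Type) : (forall m, continuous (f m)) ->
  (forall b : M -> bool, exists x, forall m, E m -> lit f m (b m) x) ->
  lept (K * nat) E ->
  exists F : X -> tychonoff_cube R K,
    continuous F /\ set_surj [set: X] [set: tychonoff_cube R K] F.
Proof.
move=> fc fE [h hI].
pose t k n x : R := clip (f (val (h (k, n))) x).
have t01 k n x : 0 <= t k n x <= 1 by exact: clip01.
pose phi k x : R := dval (t k ^~ x).
have phi01 k x : (`[0%R, 1%R]%classic : set R) (phi k x).
  by rewrite /= in_itv /=; apply: dval01.
exists (fun x k => SigSub (mem_set (phi01 k x))); split.
  apply: product_continuous => k.
  apply: (@continuous_comp_initial _ _ _ (@set_val R (`[0%R, 1%R]%classic : set R))).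
  apply: dval_continuous => // n.
  by apply: clip_continuous; exact: fc.
move=> y _.
have /choice[b bP] k : exists b : nat -> bool, dval (fun n => (b n)%:R) = set_val (y k).
  by apply: binary_expansion; have := set_valP (y k); rewrite /= in_itv.
pose c m := if pselect (exists kn, val (h kn) = m) is left p then
  let kn := projT1 (cid p) in b kn.1 kn.2 else false.
have cE k n : c (val (h (k, n))) = b k n.
  rewrite /c; case: pselect => [p|[]]; last by exists (k, n).
  by case: cid => -[k' n'] /= /val_inj/hI[-> ->].
have [x xP] := fE c; exists x => //.
apply: functional_extensionality_dep => k; apply: val_inj => /=.
apply: etrans (bP k); congr dval; apply: funext => n.
by rewrite /t; apply: clip_lit; rewrite -cE; apply: xP; exact: set_valP.
Qed.

End Dyadic.

(** * Pseudoradial spaces *)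

Section RadialClosure.
Context (X : topologicalType).

Lemma radial_closure_closed (A : set X) : radially_closed (radial_closure A).
Proof.
move=> [K [u [x [Kinf uA ux nAx]]]]; apply: nAx => C [Cr AC]; apply: contrapT => nCx.
apply: (Cr); exists K, u, x; split=> // a; exact: (uA a C (conj Cr AC)).
Qed.

Lemma sub_radial_closure (A : set X) : A `<=` radial_closure A.
Proof. by move=> x Ax C [_ ]; apply. Qed.

Lemma radial_closure_min (A B : set X) : radially_closed B -> A `<=` B ->
  radial_closure A `<=` B.
Proof. by move=> rB AB x; apply. Qed.

Lemma weakly_pseudoradial_omega (A : set X) : weakly_pseudoradial X ->
  radially_closed A -> omega_closed A.
Proof.
move=> wX Ar B cB BA; apply: subset_trans (radial_closure_min Ar BA).
move=> x Bx; apply: (wX B cB); apply: closure_subset Bx.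
exact: sub_radial_closure.
Qed.

End RadialClosure.

Lemma card_lt_sub (T U : Type) (A B : set T) (C : set U) : A `<=` B ->
  card_lt B C -> card_lt A C.
Proof.
move=> AB [BC CB]; split; first exact: card_le_trans (subset_card_le AB) BC.
by move=> CA; apply: CB; exact: card_le_trans CA (subset_card_le AB).
Qed.

(** For [B] radially closed in [Z], the set of points that [F] maps into the copy
    of [B] is radially closed: the copy of [Z] is closed, and a sequence of points
    of this copy that converges in [Y] converges in [Z]. It is then closed, hence
    compact, and so is its image, which is the copy of [B]. *)
Lemma pseudoradial_embedded (X Y Z : topologicalType) (F : X -> Y) (i : Z -> Y) :
  compact [set: X] -> hausdorff_space Y -> compact [set: Z] ->
  continuous F -> set_surj [set: X] [set: Y] F -> continuous i -> injective i ->
  pseudoradial X -> pseudoradial Z.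
Proof.
move=> cX hY cZ Fc Fs ic iI pX A0; set B := radial_closure A0.
have Br : radially_closed B by exact: radial_closure_closed.
have icl (C : set Z) : closed C -> closed (i @` C).
  move=> Ccl; apply: compact_closed => //; apply: continuous_compact.
    exact: continuous_subspaceT.
  exact: subclosed_compact cZ _.
pose B' := F @^-1` (i @` B).
have B'r : radially_closed B'.
  move=> [K [u [x [Kinf uB ux nBx]]]].
  have hit (O : set Y) : open O -> O (F x) -> card_lt [set a | ~ O (F (u a))] [set: K].
    move=> oO Ox; apply: (ux (F @^-1` O)); apply: Fc.
    exact: open_nbhs_nbhs.
  have [z zx] : exists z, i z = F x.
    apply: contrapT => nz; have [||_ h] := hit (~` (i @` setT)).
    - by apply: closed_openC; apply: icl; exact: closedT.
    - by move=> [z _ zx]; apply: nz; exists z.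
    - apply: h; apply: subset_card_le => a _ /= nS; apply: nS.
      by have [w Bw wE] := uB a; exists w.
  have /choice[w wP] a : exists w, B w /\ i w = F (u a).
    by have [w Bw wE] := uB a; exists w.
  apply: Br; exists K, w, z; split=> //.
  - by move=> a; case: (wP a).
  - move=> U; rewrite nbhsE => -[V [oV Vz] VU].
    have [||h1 h2] := hit (~` (i @` (~` V))).
    + by apply: closed_openC; apply: icl; exact: open_closedC.
    + by move=> [v nVv]; rewrite -zx => /iI vz; apply: nVv; rewrite vz.
    + apply: card_lt_sub (conj h1 h2) => a /= nU nS; apply: nS.
      by exists (w a); [move=> /VU|case: (wP a)].
  - by move=> Bz; apply: nBx; exists z.
have B'cl : closed B'.
  have -> : B' = radial_closure B'.
    by apply/seteqP; split; [exact: sub_radial_closure|exact: radial_closure_min].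
  exact: pX.
have iB : F @` B' = i @` B.
  apply/seteqP; split=> [_ [x Bx <-]//|y By].
  by have [x _ xy] := Fs y Logic.I; exists x => //; rewrite /B' /= xy.
have iBcl : closed (i @` B).
  rewrite -iB; apply: compact_closed => //; apply: continuous_compact.
    exact: continuous_subspaceT.
  exact: subclosed_compact cX _.
have -> : B = i @^-1` (i @` B).
  by apply/seteqP; split=> [z Bz|z [w Bw /iI<-]//]; exists z.
by apply: preimage_closed => // z _; exact: ic.
Qed.

Lemma hausdorff_of_functions (Y : topologicalType) (R : realType) :
  (forall p q : Y, (forall g : Y -> R, continuous g -> g p = g q) -> p = q) ->
  hausdorff_space Y.
Proof.
move=> sep p q pq; apply: sep => g gc; apply: (@Rhausdorff R) => A B Ap Bq.
have [y [Ay By]] := pq _ _ (gc p _ Ap) (gc q _ Bq).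
by exists (g y).
Qed.

Section Cubes.
Context (R : realType) (K : Type).

Lemma cube_hausdorff : hausdorff_space (tychonoff_cube R K).
Proof.
apply: (@hausdorff_of_functions _ R) => p q h.
apply: functional_extensionality_dep => k; apply: val_inj.
apply: (h (fun y : tychonoff_cube R K => set_val (y k))) => y.
apply: (@continuous_comp _ _ _ (fun y : tychonoff_cube R K => y k) set_val).
  exact: eval_continuous.
exact: initial_continuous.
Qed.

Lemma bool_cube_compact : compact [set: {ptws K -> bool}].
Proof.
have := @tychonoff {classic K} (fun=> bool) (fun=> setT) (fun=> bool_compact).
by congr compact; apply/seteqP; split.
Qed.

Lemma bit01 (b : bool) : (`[0%R, 1%R]%classic : set R) b%:R.
Proof. by case: b; rewrite /= in_itv /= ?lexx ?ler01. Qed.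

Definition corner (b : {ptws K -> bool}) : tychonoff_cube R K :=
  fun k => SigSub (mem_set (bit01 (b k))).

Lemma corner_continuous : continuous corner.
Proof.
apply: product_continuous => k.
apply: (@continuous_comp_initial _ _ _ (@set_val R (`[0%R, 1%R]%classic : set R))).
move=> b; apply: (@continuous_comp {ptws K -> bool} bool R
    (fun b : {ptws K -> bool} => b k) (fun c => c%:R)).
  exact: (@eval_continuous K (fun=> bool)).
by move=> U Ub; rewrite nbhs_simpl /= nbhs_principalE => c ->; exact: nbhs_singleton Ub.
Qed.

Lemma corner_inj : injective corner.
Proof.
move=> b c bc; apply: functional_extensionality_dep => k.
have e : (b k)%:R = (c k)%:R :> R :=
  congr1 (fun y : tychonoff_cube R K => set_val (y k)) bc.
by case: (b k) (c k) e => [] [] // /eqP; rewrite ?(eq_sym 0%R) oner_eq0.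
Qed.

End Cubes.

(** All continuous functions that vanish at [x]: their only common zero is [x]. *)
Lemma escape_of_not_closed (R : realType) (X : topologicalType) (A : set X) (x : X) :
  compact [set: X] -> hausdorff_space X -> closure A x -> ~ A x ->
  escape R A {f : X -> R | continuous f /\ f x = 0}.
Proof.
move=> cX hX Ax nAx; exists A, sval; split=> //.
- by move=> f; exact: (svalP f).1.
- by exists x; split=> // f; exact: (svalP f).2.
move=> [a [Aa _ fa]].
have [||f [fc fx f1]] := separating_function R cX hX (p := x) (U := ~` [set a]).
- by apply: closed_openC; exact: accessible_closed_set1 (hausdorff_accessible hX) a.
- by move=> xa; apply: nAx; rewrite xa.
have gc : continuous (fun y => Num.max 0 (f y)).
  move=> y; apply: (@continuous_max R X (fun=> 0) f); [exact: cvg_cst|exact: fc].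
have gx : Num.max 0 (f x) = 0 by rewrite max_l // ltW.
have := fa (exist _ _ (conj gc gx)) => /= /max_idPl fa0.
by have := le_trans (f1 a (fun h => h erefl)) fa0; rewrite ler10.
Qed.

(** The recursion takes place on the residue of a minimal escape. *)
Lemma aleph2_cube_surjection (R : realType) (M : cardinal) (X : topologicalType)
    (A : set X) : is_aleph 2 M ->
  compact [set: X] -> hausdorff_space X -> omega_closed A -> radially_closed A ->
  ~ closed A ->
  forall K : Type, lept K M -> exists f : X -> tychonoff_cube R K,
    continuous f /\ set_surj [set: X] [set: tychonoff_cube R K] f.
Proof.
move=> aM; have [L [aL ML Mmin]] := is_alephSP aM.
have [Lunc Lmin [ltL [woL segL]]] := is_aleph1P aL.
have [ltM [woM segM]] := least_segments Mmin.
have [LnL LL] := lept_mul_self woL segL Lunc.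
have nL : lept nat L by case: (lept_total nat L).
move=> cX hX Aw Ar nAcl K KM.
have [x [Ax nAx]] : exists x, closure A x /\ ~ A x.
  apply: contrapT => h; apply: nAcl => x Ax; apply: contrapT => nAx.
  by apply: h; exists x.
have [J [lt [wo [D [f [DA fc H0 nA]]] Jmin Jinit]]] :=
  minimal_escape (escape_of_not_closed R cX hX Ax nAx).
have HA a : A a -> ~ residue D f a.
  by move=> Aa [Da fa]; apply: nA; exists a.
have [|g [E [gc EL gE]]] :=
    independent_functions (R := R) cX hX (residue_closed fc) H0 woM nL LL segM ML.
  move=> d m good [p [Hp dense]].
  apply: (no_dense_point cX hX Aw Ar wo Jmin Jinit DA fc H0 HA woL segL Lunc Lmin
    (g := fun i => sval (d i).2) (P := below ltM d m) (S := [set k | ltM k m]) _ _ _ _ _ (segM m) _ Hp dense).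
  - by move=> i; exact: (svalP (d i).2).
  - by split=> //; exact: admissible_nil.
  - move=> s t [sa sm] [ta tm] st; split; first exact: admissible_cat.
    by move=> i e /In_cat[/sm|/tm].
  - by move=> s [[]].
  - by move=> s [_ sm] i e /sm.
  - move=> s [sa sm]; apply: (admissible_sat H0 woM sa) => i e /sm im.
    exact: good.
apply: (cube_surjection gc gE).
apply: (lept_trans (lept_mul KM (lept_refl nat))).
apply: (lept_mul_nat woM) => w Ew; apply: EL; apply: (lept_trans Ew).
apply: lept_trans LnL; apply: lept_mul (lept_refl _).
apply: (lept_setU nL LL (A := [set w' | ltM w' w]) (B := [set w])) => //.
exact: lept_set1.
Qed.

Theorem theorem1p1 (R : realType) (pse aleph2 : cardinal)
    (pseP : is_pse pse) (aleph2P : is_aleph 2 aleph2)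
    (pse_le : [set: pse] #<= [set: aleph2])
    (X : topologicalType)
    (X_compact : compact [set: X]) (X_hausdorff : hausdorff_space X)
    (X_wpr : weakly_pseudoradial X) :
  pseudoradial X <->
  ~ exists f : X -> tychonoff_cube R pse,
      continuous f /\ set_surj [set: X] [set: tychonoff_cube R pse] f.
Proof.
split=> [pX [F [Fc Fs]]|nF A0].
  apply: pseP.1; apply: (pseudoradial_embedded X_compact _ _ Fc Fs _ _ pX).
  - exact: cube_hausdorff.
  - exact: bool_cube_compact.
  - exact: corner_continuous.
  - exact: corner_inj.
apply: contrapT => nAcl; apply: nF.
have Ar := @radial_closure_closed X A0.
apply: (aleph2_cube_surjection R aleph2P X_compact X_hausdorff _ Ar nAcl).
  exact: weakly_pseudoradial_omega.
exact/card_leTP.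
Qed.
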